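(* Let $\alpha\in\mathbb D$, let $\omega$ be a neighborhood of $\alpha$ and let $\varphi\in\mathrm{Hol}(\omega,\mathbb G_n)$. Let $A_1\in\mathcal M_n$ be a block diagonal matrix in Jordan form with diagonal blocks $B_1,\dots,B_s$, where $B_j\in\mathcal M_{m_j}$, $\sum_{j=1}^sm_j=n$, $\mathrm{Sp}(B_j)=\{\lambda_j\}$, and $\lambda_j\ne\lambda_k$ for $j\neq k$. Then the following assertions are equivalent: (a) There exist a neighborhood $\omega'\subset\mathbb D$ of $\alpha$ and $\Phi\in\mathrm{Hol}(\omega',\Omega_n)$ such that $\pi\circ\Phi=\varphi$ and $\Phi(\alpha)=A_1$. (b) The map $\varphi$ satisfies $$\frac{d^kP_{[\varphi(\zeta)]}}{dt^k}(\lambda_j)=O\big((\zeta-\alpha)^{d_{m_j-k}(B_j)}\big)\ \text{ as }\zeta\to\alpha,\qquad 0\le k\le m_j-1,\ 1\le j\le s.$$ (c) There exist a neighborhood $\omega'\subset\mathbb D$ of $\alpha$ and $\Phi\in\mathrm{Hol}(\omega',\Omega_n)$ such that $\pi\circ\Phi=\varphi$, $\Phi(\alpha)=A_1$, and $\Phi(\zeta)$ is cyclic for $\zeta\in\omega'\setminus\{\alpha\}$.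
   Context: $\mathbb D=\{z\in\mathbb C:|z|<1\}$; $\mathrm{Hol}(X,Y)$ is the set of holomorphic maps from $X$ to $Y$. $\mathcal M_n$ is the set of $n\times n$ complex matrices, $\mathrm{Sp}(A)$ the spectrum of $A$, and $\Omega_n=\{A\in\mathcal M_n:\max_{\lambda\in \mathrm{Sp}(A)}|\lambda|<1\}$. The map $\pi=(\sigma_1,\dots,\sigma_n):\mathcal M_n\to\mathbb C^n$ is defined by $\det(tI_n-A)=t^n+\sum_{j=1}^n(-1)^j\sigma_j(A)t^{n-j}$. The symmetrized polydisc is $\mathbb G_n=\pi(\Omega_n)$. For $v=(v_1,\dots,v_n)\in\mathbb C^n$, $P_{[v]}(t)=t^n+\sum_{j=1}^n(-1)^jv_jt^{n-j}$. The derivatives $d^k/dt^k$ are taken with respect to the indeterminate $t$ of the polynomial. A matrix $A\in\mathcal M_n$ is cyclic if there is $v\in\mathbb C^n$ such that $\{A^kv:k\ge0\}$ spans $\mathbb C^n$. The equality $\pi\circ\Phi=\varphi$ is understood on the common domain near $\alpha$. Definition of $d_i(B)$: let $B=(b_{i,j})\in\mathcal M_m$ be a matrix with a single eigenvalue $\lambda$ in upper triangular Jordan form (that is, $b_{jj}=\lambda$, $b_{j-1,j}\in\{0,1\}$, all other entries $0$), with the Jordan blocks arranged along the diagonal in non-decreasing order of size. Let $r$ be the rank of $B-\lambda I_m$ and write $\{j\in\{2,\dots,m\}:b_{j-1,j}=0\}=\{b_2<\dots<b_{m-r}\}$ (possibly empty). For $1\le i\le m$, $d_i(B)=1+\#\{k: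 m-i+2\le b_k\le m\}$. All Jordan forms are understood with this ordering of Jordan blocks within each eigenvalue. *)

(* Defs.v *)
From HB Require Import structures.
From mathcomp Require Import all_boot all_order all_algebra.
From mathcomp Require Import complex.
From mathcomp Require Import all_classical all_reals all_analysis.

Set Implicit Arguments.
Unset Strict Implicit.
Unset Printing Implicit Defensive.

Import Order.TTheory GRing.Theory Num.Theory.
Import numFieldNormedType.Exports.

Local Open Scope classical_set_scope.
Local Open Scope ring_scope.

(* R[i] is named as a [numClosedFieldType] so that the norm topology and the  *)
(* normed-module structures of [numFieldNormedType] are inferred on it.       *)
Definition Cplx (R : realType) : numClosedFieldType := R[i].

Section Definitions.
Variable R : realType.
Local Notation C := (Cplx R).

Definition unit_disc : set C := [set z | `|z| < 1].

(* Meant for open X; since f is a total function, complex differentiability   *)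
(* at the points of X then only depends on the restriction of f to X.         *)
Definition Hol (V : normedModType C) (X : set C) (Y : set V) : set (C -> V) :=
  [set f | (forall z, X z -> derivable f z 1) /\ (forall z, X z -> Y (f z))].

Definition Sp n (A : 'M[C]_n) : set C := [set a | eigenvalue A a].

Definition Omega n : set 'M[C]_n :=
  [set A | forall a, Sp A a -> `|a| < 1].

(* Vectors are 0-based: entry j of [sigma A] is $\sigma_{j+1}(A)$.            *)
Definition sigma n (A : 'M[C]_n) : 'rV[C]_n :=
  \row_(j < n) ((-1) ^+ j.+1 * (char_poly A)`_(n - j.+1)).

Definition sym_polydisc n : set 'rV[C]_n := @sigma n @` @Omega n.

Definition Ppoly n (v : 'rV[C]_n) : {poly C} :=
  'X^n + \sum_(j < n) ((-1) ^+ j.+1 * v 0 j) *: 'X^(n - j.+1).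

Lemma char_poly_sigma n (A : 'M[C]_n) : char_poly A = Ppoly (sigma A).
Proof.
have sz := size_char_poly A; have mon := char_poly_monic A.
rewrite /Ppoly -[LHS]coefK sz poly_def big_ord_recr /= addrC; congr (_ + _).
  by move: mon; rewrite monicE lead_coefE sz /= => /eqP ->; rewrite scale1r.
rewrite (reindex_inj rev_ord_inj) /=; apply: eq_bigr => j _.
by rewrite mxE mulrA -expr2 sqrr_sign mul1r.
Qed.

Definition cyclic_mx n (A : 'M[C]_n) : Prop :=
  exists v : 'cV[C]_n, forall w : 'cV[C]_n,
    exists (N : nat) (c : 'I_N -> C), w = \sum_(k < N) c k *: (A ^+ k *m v).

(* The 1-based positions $b_2 < b_3 < \dots$ of the columns j >= 2 with       *)
(* $b_{j-1,j} = 0$, i.e. where a Jordan block other than the first starts.    *)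
Definition block_starts m (B : 'M[C]_m) : seq nat :=
  [seq (val j).+1 | j : 'I_m <- enum 'I_m &
                      [exists i : 'I_m, (i.+1 == j) && (B i j == 0)]].

(* Consecutive differences of 1, $b_2$, $b_3$, ..., m + 1.                    *)
Definition block_sizes m (B : 'M[C]_m) : seq nat :=
  pairmap (fun b b' => (b' - b)%N) 1%N (rcons (block_starts B) m.+1).

Definition jordan_form m (l : C) (B : 'M[C]_m) : Prop :=
  [/\ forall i, B i i = l,
      forall i j : 'I_m, i.+1 = j -> B i j = 0 \/ B i j = 1,
      forall i j : 'I_m, i != j -> i.+1 <> j -> B i j = 0
    & sorted leq (block_sizes B)].

Definition djordan m (B : 'M[C]_m) (i : nat) : nat :=
  (1 + count (fun b => m - i + 2 <= b <= m) (block_starts B))%N.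

End Definitions.

Arguments unit_disc {R}.
Arguments Omega {R} n.
Arguments sym_polydisc {R} n.

(* Main.v *)
Require Import Defs.
From HB Require Import structures.
From mathcomp Require Import all_boot all_order all_algebra.
From mathcomp Require Import fingroup perm.
From mathcomp Require Import complex.
From mathcomp Require Import all_classical all_reals all_analysis.
From mathcomp Require Import ring lra zify.

Set Implicit Arguments.
Unset Strict Implicit.
Unset Printing Implicit Defensive.

Import Order.TTheory GRing.Theory Num.Theory.
Import numFieldNormedType.Exports.

Local Open Scope classical_set_scope.
Local Open Scope ring_scope.

(**
  (a) => (b).  Write [Phi z - lambda_j = (A1 - lambda_j) + O(z - alpha)] and
  expand the coefficient of [x ^ k] in [det (x - (Phi z - lambda_j))] by
  Leibniz: one term for each permutation [p] and each set [T] of [k] rows,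
  fixed by [p], that contribute [x].  In every Jordan block of [B_j] not
  contained in [T], the last row outside [T] meets a zero entry of
  [A1 - lambda_j], hence contributes a factor [O(z - alpha)]; since the blocks
  are sorted, at least [d_(m_j - k)] of them are not contained in [T].

  (b) => (c).  No holomorphic factorization of [P] is needed.  Let [N z] be
  [A1] with [z - alpha] in place of the zeros of the superdiagonal inside each
  [B_j], let [u] be the sum of the last basis vectors of the [s] groups, and
  put [Phi z = N z + u w(z)], a rank one perturbation.  Its characteristic
  polynomial is [D] minus a combination of the [(t - lambda_j)^a D_j(t)], where
  [D = prod_j (t - lambda_j)^m_j] and [D_j = D / (t - lambda_j)^m_j]; by
  partial fractions every monic polynomial of degree [n] is obtained, and the
  weight [w_(j, a)] is a Taylor coefficient at [lambda_j] of a fixed multiple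
  of [P_(phi z)], divided by a power of [z - alpha] that (b) controls.  Off
  [alpha] the vector [u] is cyclic, by Hautus' criterion.

  The weights are holomorphic at [alpha] because a differentiable function
  that is [O((z - alpha)^d)] is [(z - alpha)^d] times a function with a limit
  at [alpha].  This follows from Goursat's theorem and Cauchy's formula on
  squares, in the form [f(z) C_1(z) = C_f(z)] with
  [C_k(z) = oint k(w) / (w - z) dw], and from
  [C_k(z) = C_k(alpha) + (z - alpha) C_(k / (. - alpha))(z)].
*)

(** * Complex integration along squares *)

Section ComplexAnalysis.
Variable R : realType.
Local Notation C := (Cplx R).
Local Notation mu := (@lebesgue_measure R).

Definition cRe (z : C) : R := complex.Re z.
Definition cIm (z : C) : R := complex.Im z.
(** The norm [|z|] of a [numClosedFieldType] is an element of [C]; this is the same modulus with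
    values in [R], where estimates can be left to [lra]. *)
Definition cnorm (z : C) : R := Normc.normc z.
Definition toC (x : R) : C := (x%:C)%C.
Definition ci : C := ('i : R[i])%C.

Lemma cnormE (z : C) : `|z| = toC (cnorm z).
Proof. by []. Qed.

Lemma ltc_toC (x y : R) : (toC x < toC y) = (x < y).
Proof. exact: ltcR. Qed.

Lemma lec_toC (x y : R) : (toC x <= toC y) = (x <= y).
Proof. exact: lecR. Qed.

Lemma toCD x y : toC (x + y) = toC x + toC y.
Proof. exact: (rmorphD (real_complex R)). Qed.
Lemma toCB x y : toC (x - y) = toC x - toC y.
Proof. exact: (rmorphB (real_complex R)). Qed.
Lemma toCM x y : toC (x * y) = toC x * toC y.
Proof. exact: (rmorphM (real_complex R)). Qed.
Lemma toC0 : toC 0 = 0. Proof. by []. Qed.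
Lemma toC1 : toC 1 = 1. Proof. by []. Qed.

Lemma toC_inj : injective toC.
Proof. by move=> x y []. Qed.

Lemma gt0_toC (e : C) : 0 < e -> exists2 r : R, 0 < r & e = toC r.
Proof.
move=> e0; exists (cRe e); last first.
  by have /ger0_real/RRe_real := ltW e0.
by move: e0; rewrite ltcE => /andP[].
Qed.

Lemma ltr_cnorm (z : C) (e : R) : (`|z| < toC e) = (cnorm z < e).
Proof. by rewrite cnormE ltc_toC. Qed.

Lemma ler_cnorm (z : C) (e : R) : (`|z| <= toC e) = (cnorm z <= e).
Proof. by rewrite cnormE lec_toC. Qed.

Lemma cnorm_ge0 z : 0 <= cnorm z.
Proof. by rewrite -ler0c -/(toC _) -cnormE. Qed.

Lemma cnormM z w : cnorm (z * w) = cnorm z * cnorm w.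
Proof. exact: Normc.normcM. Qed.

Lemma cnormV z : cnorm z^-1 = (cnorm z)^-1.
Proof. exact: Normc.normcV. Qed.

Lemma cnormD z w : cnorm (z + w) <= cnorm z + cnorm w.
Proof. by rewrite -lec_toC toCD -!cnormE ler_normD. Qed.

Lemma cnormB z w : cnorm (z - w) = cnorm (w - z).
Proof. by apply: toC_inj; rewrite -!cnormE distrC. Qed.

Lemma cnormN z : cnorm (- z) = cnorm z.
Proof. by apply: toC_inj; rewrite -!cnormE normrN. Qed.

Lemma cnorm0 : cnorm 0 = 0.
Proof. by apply: toC_inj; rewrite -!cnormE normr0. Qed.

Lemma cnorm_eq0 z : (cnorm z == 0) = (z == 0).
Proof.
apply/eqP/eqP => [|->]; last exact: cnorm0.
by move=> z0; apply/eqP; rewrite -normr_eq0 cnormE z0.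
Qed.

Lemma cnorm_gt0 z : (0 < cnorm z) = (z != 0).
Proof. by rewrite lt_def cnorm_eq0 cnorm_ge0 andbT. Qed.

Lemma cnorm_toC x : cnorm (toC x) = `|x|.
Proof. by rewrite /cnorm /= expr0n addr0 sqrtr_sqr. Qed.

Lemma cnorm_ci : cnorm ci = 1.
Proof. by rewrite /cnorm /= expr0n add0r expr1n sqrtr1. Qed.

Lemma cReB z w : cRe (z - w) = cRe z - cRe w.
Proof. by case: z => a b; case: w. Qed.
Lemma cImB z w : cIm (z - w) = cIm z - cIm w.
Proof. by case: z => a b; case: w. Qed.

Lemma ge_cnorm_Re z : `|cRe z| <= cnorm z.
Proof. by have := normc_ge_Re z; rewrite lecR. Qed.

Lemma ge_cnorm_Im z : `|cIm z| <= cnorm z.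
Proof.
rewrite -[cnorm z]mulr1 -cnorm_ci -cnormM; apply: le_trans (ge_cnorm_Re _).
by rewrite /cRe ReiNIm normrN.
Qed.

Lemma cReIm z : z = toC (cRe z) + ci * toC (cIm z).
Proof. exact: complexE. Qed.

Lemma le_cnorm_ReIm z : cnorm z <= `|cRe z| + `|cIm z|.
Proof.
rewrite {1}[z]cReIm; apply: le_trans (cnormD _ _) _.
by rewrite cnormM cnorm_ci mul1r !cnorm_toC.
Qed.

Lemma continuousP_cnorm (T : topologicalType) (f : T -> C) (z : T) :
  {for z, continuous f} <-> forall e : R, 0 < e -> \forall w \near z, cnorm (f w - f z) < e.
Proof.
split=> [/cvgrPdist_lt H e e0|H].
  have := H (toC e); rewrite -toC0 ltc_toC => /(_ e0); apply: filterS => w.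
  by rewrite distrC ltr_cnorm.
by apply/cvgrPdist_lt => _/gt0_toC[e e0 ->]; apply: filterS (H e e0) => w; rewrite distrC ltr_cnorm.
Qed.

Lemma nbhs_cnormP (z : C) (P : set C) :
  nbhs z P <-> exists2 e : R, 0 < e & forall w, cnorm (w - z) < e -> P w.
Proof.
split=> [/nbhs_ballP|] -[e /= e0 H]; last first.
  apply/nbhs_ballP; exists (toC e) => /=; first by rewrite -toC0 ltc_toC.
  by move=> w /=; rewrite distrC ltr_cnorm => /H.
have [r r0 er] := gt0_toC e0; exists r => // w wz; apply: H.
by rewrite -ball_normE /ball_ /= er distrC ltr_cnorm.
Qed.

Lemma continuous_Re : continuous cRe.
Proof.
move=> z; apply/(@cvgrPdist_lt _ R^o C (nbhs z)) => e e0; apply/nbhs_cnormP; exists e => // w.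
by rewrite cnormB -cReB; apply: le_lt_trans; exact: ge_cnorm_Re.
Qed.

Lemma continuous_Im : continuous cIm.
Proof.
move=> z; apply/(@cvgrPdist_lt _ R^o C (nbhs z)) => e e0; apply/nbhs_cnormP; exists e => // w.
by rewrite cnormB -cImB; apply: le_lt_trans; exact: ge_cnorm_Im.
Qed.

(** * Integrals of complex functions over a segment *)

Definition ccont (u : R -> C) (a b : R) :=
  forall t, a <= t <= b -> {for t, continuous u}.

Definition cint (u : R -> C) (a b : R) : C := locked
  (toC (\int[mu]_(t in `[a, b]) cRe (u t)) + ci * toC (\int[mu]_(t in `[a, b]) cIm (u t))).

Lemma cintE u a b : cint u a b =
  toC (\int[mu]_(t in `[a, b]) cRe (u t)) + ci * toC (\int[mu]_(t in `[a, b]) cIm (u t)).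
Proof. by rewrite /cint -lock. Qed.

Lemma integrable_Re u a b : ccont u a b -> mu.-integrable `[a, b] (EFin \o (cRe \o u)).
Proof.
move=> cu; apply: continuous_compact_integrable; first exact: segment_compact.
apply: continuous_in_subspaceT => t; rewrite inE /= in_itv /= => tab.
by apply: continuous_comp; [exact: cu|exact: continuous_Re].
Qed.

Lemma integrable_Im u a b : ccont u a b -> mu.-integrable `[a, b] (EFin \o (cIm \o u)).
Proof.
move=> cu; apply: continuous_compact_integrable; first exact: segment_compact.
apply: continuous_in_subspaceT => t; rewrite inE /= in_itv /= => tab.
by apply: continuous_comp; [exact: cu|exact: continuous_Im].
Qed.

Lemma eq_cint u v a b : (forall t, a <= t <= b -> u t = v t) -> cint u a b = cint v a b.
Proof.
move=> uv; rewrite !cintE.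
by congr (toC _ + _ * toC _); apply: eq_Rintegral => t; rewrite inE /= in_itv /= => /uv ->.
Qed.

Lemma cintB u v a b : ccont u a b -> ccont v a b ->
  cint (fun t => u t - v t) a b = cint u a b - cint v a b.
Proof.
move=> cu cv; rewrite !cintE.
under eq_Rintegral do rewrite cReB.
under [X in _ + _ * toC X]eq_Rintegral do rewrite cImB.
rewrite !RintegralB // ?toCB; first by ring.
- exact: integrable_Im.
- exact: integrable_Im.
- exact: integrable_Re.
- exact: integrable_Re.
Qed.

Lemma cintZ c u a b : ccont u a b -> cint (fun t => c * u t) a b = c * cint u a b.
Proof.
move=> cu; rewrite !cintE.
have iR := integrable_Re cu; have iI := integrable_Im cu.
have ReM (x y : C) : cRe (x * y) = cRe x * cRe y - cIm x * cIm y by case: x => ? ?; case: y.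
have ImM (x y : C) : cIm (x * y) = cRe x * cIm y + cIm x * cRe y.
  by case: x => ? ?; case: y => ? ?; rewrite /= addrC.
under eq_Rintegral do rewrite ReM.
under [X in _ + _ * toC X]eq_Rintegral do rewrite ImM.
have iZ (k : R) (f : R -> R) : mu.-integrable `[a, b] (EFin \o f) ->
    mu.-integrable `[a, b] (EFin \o (fun x => k * f x)).
  by move=> fi; rewrite (_ : EFin \o _ = (fun x => k%:E * (EFin \o f) x)%E) //; exact: integrableZl.
rewrite RintegralB ?RintegralD ?RintegralZl //; try exact: iZ.
rewrite toCB toCD !toCM {5}[c]cReIm.
have ii : ci * ci = -1 by rewrite -expr2; exact: sqr_i.
by rewrite -[X in X - _ + _]mul1r -[1]opprK -ii; ring: ii.
Qed.

Lemma Rintegral_itv_cst (c a b : R) : a <= b -> \int[mu]_(t in `[a, b]) c = c * (b - a).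
Proof.
move=> ab; rewrite Rintegral_cst //; congr (_ * _).
have -> : fine (lebesgue_measure `[a, b]) = b - a; last by [].
rewrite lebesgue_measure_itv /= lte_fin.
by case: ltgtP ab => //= -> _; rewrite subrr.
Qed.

Lemma cint_cst c a b : a <= b -> cint (fun=> c) a b = c * toC (b - a).
Proof.
move=> ab; rewrite !cintE !Rintegral_itv_cst //.
by rewrite !toCM {3}[c]cReIm; ring.
Qed.

Lemma cint_split u a b c : a <= b -> b <= c -> ccont u a c ->
  cint u a c = cint u a b + cint u b c.
Proof.
move=> ab bc cu.
have H (f : R -> R) : mu.-integrable `[a, c] (EFin \o f) ->
    \int[mu]_(t in `[a, c]) f t = \int[mu]_(t in `[a, b]) f t + \int[mu]_(t in `[b, c]) f t.
  move=> fi; rewrite -(@Rintegral_itv_obnd_cbnd _ b) -?(@Rintegral_itvB _ _ (BLeft a) _ b) //; first by ring.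
  by apply: integrableS fi => //; apply: subset_itvr; rewrite bnd_simp.
rewrite !cintE !H ?toCD; first by ring.
- exact: integrable_Im.
- exact: integrable_Re.
Qed.

(** The factor [2] comes from bounding the real and imaginary parts separately. *)
Lemma cint_norm_le u a b M : a <= b -> ccont u a b ->
  (forall t, a <= t <= b -> cnorm (u t) <= M) -> cnorm (cint u a b) <= 2 * M * (b - a).
Proof.
move=> ab cu uM.
have H (f : R -> R) : mu.-integrable `[a, b] (EFin \o f) ->
    (forall t, a <= t <= b -> `|f t| <= M) -> `|\int[mu]_(t in `[a, b]) f t| <= M * (b - a).
  move=> fi fM; apply: le_trans (le_normr_Rintegral _ fi) _ => //.
  have -> : M * (b - a) = \int[mu]_(t in `[a, b]) M.
    by rewrite Rintegral_itv_cst.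
  apply: le_Rintegral => //.
  - exact: (integrable_norm fi).
  - by apply: continuous_compact_integrable; [exact: segment_compact|move=> ?; exact: cvg_cst].
rewrite cintE; apply: le_trans (cnormD _ _) _.
rewrite cnormM cnorm_ci mul1r !cnorm_toC -mulrA mulr_natl mulr2n.
apply: lerD; apply: H.
- exact: integrable_Re.
- by move=> t /uM; apply: le_trans; exact: ge_cnorm_Re.
- exact: integrable_Im.
- by move=> t /uM; apply: le_trans; exact: ge_cnorm_Im.
Qed.

Lemma cint_Im_ge u a b m : a <= b -> ccont u a b ->
  (forall t, a <= t <= b -> m <= cIm (u t)) -> m * (b - a) <= cIm (cint u a b).
Proof.
move=> ab cu um; rewrite !cintE.
have -> : m * (b - a) = \int[mu]_(t in `[a, b]) m.
  by rewrite Rintegral_itv_cst.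
have -> (x y : R) : cIm (toC x + ci * toC y) = y by rewrite /cIm /= ; ring.
apply: le_Rintegral => //.
- by apply: continuous_compact_integrable; [exact: segment_compact|move=> ?; exact: cvg_cst].
- exact: integrable_Im.
Qed.

Arguments cnorm : simpl never.
Arguments cRe : simpl never.
Arguments cIm : simpl never.

(** * Integrals along the boundary of a square *)

Definition pt (x y : R) : C := toC x + ci * toC y.

Lemma Re_pt x y : cRe (pt x y) = x.
Proof. by rewrite /cRe /pt /=; ring. Qed.

Lemma Im_pt x y : cIm (pt x y) = y.
Proof. by rewrite /cIm /pt /=; ring. Qed.

Lemma ccont_horizontal f y a b : (forall t, a <= t <= b -> {for pt t y, continuous f}) ->
  ccont (fun t => f (pt t y)) a b.
Proof.
move=> cf t tab; apply: (@continuous_comp _ _ _ (fun t => pt t y) f); last exact: cf.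
apply/continuousP_cnorm => e e0; near=> s.
rewrite /pt opprD addrACA subrr addr0 -toCB cnorm_toC distrC.
by near: s; apply: cvgr_dist_lt.
Unshelve. all: by end_near. Qed.

Lemma ccont_vertical f x a b : (forall t, a <= t <= b -> {for pt x t, continuous f}) ->
  ccont (fun t => f (pt x t)) a b.
Proof.
move=> cf t tab; apply: (@continuous_comp _ _ _ (fun t => pt x t) f); last exact: cf.
apply/continuousP_cnorm => e e0; near=> s.
rewrite /pt opprD addrACA subrr add0r -mulrBr -toCB cnormM cnorm_ci mul1r cnorm_toC distrC.
by near: s; apply: cvgr_dist_lt.
Unshelve. all: by end_near. Qed.

(** The counterclockwise contour integral around the square with lower left corner [pt x y]: [dw] is
    [dt] on the horizontal sides and [i dt] on the vertical ones. *)
Definition sq_int (f : C -> C) (x y L : R) : C := locked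
  (cint (fun t => f (pt t y)) x (x + L) - cint (fun t => f (pt t (y + L))) x (x + L)
   + ci * (cint (fun t => f (pt (x + L) t)) y (y + L) - cint (fun t => f (pt x t)) y (y + L))).

Lemma sq_intE f x y L : sq_int f x y L =
  cint (fun t => f (pt t y)) x (x + L) - cint (fun t => f (pt t (y + L))) x (x + L)
  + ci * (cint (fun t => f (pt (x + L) t)) y (y + L) - cint (fun t => f (pt x t)) y (y + L)).
Proof. by rewrite /sq_int -lock. Qed.

Definition in_sq (x y L : R) (w : C) := x <= cRe w <= x + L /\ y <= cIm w <= y + L.

Definition on_sq (x y L : R) (w : C) := in_sq x y L w /\
  [\/ cRe w = x, cRe w = x + L, cIm w = y | cIm w = y + L].

Definition cont_on (P : C -> Prop) (f : C -> C) := forall w, P w -> {for w, continuous f}.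

Ltac gen_cint := repeat match goal with
  |- context [cint ?u ?a ?b] => let z := fresh "z" in move: (cint u a b) => z end.

Section OnSq.
Variables (x y L : R).
Hypothesis L0 : 0 <= L.

Lemma on_sq_bottom t : x <= t <= x + L -> on_sq x y L (pt t y).
Proof.
by move=> tx; split; [split; rewrite ?Re_pt ?Im_pt // lexx lerDl|apply: Or43; rewrite Im_pt].
Qed.

Lemma on_sq_top t : x <= t <= x + L -> on_sq x y L (pt t (y + L)).
Proof.
by move=> tx; split; [split; rewrite ?Re_pt ?Im_pt // lexx lerDl L0|apply: Or44; rewrite Im_pt].
Qed.

Lemma on_sq_left t : y <= t <= y + L -> on_sq x y L (pt x t).
Proof.
by move=> tx; split; [split; rewrite ?Re_pt ?Im_pt // lexx lerDl|apply: Or41; rewrite Re_pt].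
Qed.

Lemma on_sq_right t : y <= t <= y + L -> on_sq x y L (pt (x + L) t).
Proof.
by move=> tx; split; [split; rewrite ?Re_pt ?Im_pt // lexx lerDl L0|apply: Or42; rewrite Re_pt].
Qed.

Lemma on_sq_ccont f : cont_on (on_sq x y L) f ->
  [/\ ccont (fun t => f (pt t y)) x (x + L), ccont (fun t => f (pt t (y + L))) x (x + L),
      ccont (fun t => f (pt x t)) y (y + L) & ccont (fun t => f (pt (x + L) t)) y (y + L)].
Proof.
move=> cf; split.
- by apply: ccont_horizontal => t /on_sq_bottom /cf.
- by apply: ccont_horizontal => t /on_sq_top /cf.
- by apply: ccont_vertical => t /on_sq_left /cf.
- by apply: ccont_vertical => t /on_sq_right /cf.
Qed.

Lemma eq_sq_int f g : (forall w, on_sq x y L w -> f w = g w) -> sq_int f x y L = sq_int g x y L.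
Proof.
move=> fg; rewrite !sq_intE; congr (_ - _ + _ * (_ - _)); apply: eq_cint => t tab; apply: fg.
- exact: on_sq_bottom.
- exact: on_sq_top.
- exact: on_sq_right.
- exact: on_sq_left.
Qed.

Lemma sq_intB f g : cont_on (on_sq x y L) f -> cont_on (on_sq x y L) g ->
  sq_int (fun w => f w - g w) x y L = sq_int f x y L - sq_int g x y L.
Proof.
move=> /on_sq_ccont[f1 f2 f3 f4] /on_sq_ccont[g1 g2 g3 g4].
by rewrite !sq_intE (cintB f1 g1) (cintB f2 g2) (cintB f3 g3) (cintB f4 g4); gen_cint; clear; ring.
Qed.

Lemma sq_intZ c f : cont_on (on_sq x y L) f ->
  sq_int (fun w => c * f w) x y L = c * sq_int f x y L.
Proof.
by move=> /on_sq_ccont[f1 f2 f3 f4]; rewrite !sq_intE (cintZ c f1) (cintZ c f2) (cintZ c f3) (cintZ c f4); ring.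
Qed.

(** On opposite sides the integrands differ by a constant: bottom minus top gives [- b i L ^ 2],
    right minus left gives [b L ^ 2], and the latter is multiplied by [i]. *)
Lemma sq_int_affine a b : sq_int (fun w => a + b * w) x y L = 0.
Proof.
have cf w : {for w, continuous (fun w => a + b * w : C)}.
  by apply: (@continuousD _ _ _ (cst a) (fun w => b * w)); [exact: cst_continuous|exact: mulrl_continuous].
have [|h1 h2 h3 h4] := @on_sq_ccont (fun w => a + b * w) => //.
rewrite !sq_intE -(cintB h1 h2) -(cintB h4 h3).
rewrite (@eq_cint _ (fun=> - (b * ci * toC L))); last by move=> t _; rewrite /pt toCD; ring.
rewrite [X in _ + _ * X](@eq_cint _ (fun=> b * toC L)); last by move=> t _; rewrite /pt toCD; ring.
by rewrite !cint_cst ?lerDl // !(addrC _ L) !addrK; ring.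
Qed.

(** The constant [8] is four sides times the [2] of [cint_norm_le]. *)
Lemma sq_int_norm_le f M : cont_on (on_sq x y L) f ->
  (forall w, on_sq x y L w -> cnorm (f w) <= M) -> cnorm (sq_int f x y L) <= 8 * M * L.
Proof.
move=> /on_sq_ccont[f1 f2 f3 f4] fM; rewrite !sq_intE.
have e0 z : z + L - z = L by ring.
have i1 := @cint_norm_le _ x (x + L) M _ f1 (fun t tab => fM _ (on_sq_bottom tab)).
have i2 := @cint_norm_le _ x (x + L) M _ f2 (fun t tab => fM _ (on_sq_top tab)).
have i3 := @cint_norm_le _ y (y + L) M _ f3 (fun t tab => fM _ (on_sq_left tab)).
have i4 := @cint_norm_le _ y (y + L) M _ f4 (fun t tab => fM _ (on_sq_right tab)).
rewrite !lerDl !e0 in i1 i2 i3 i4.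
apply: le_trans (cnormD _ _) _; rewrite cnormM cnorm_ci mul1r.
apply: le_trans (lerD (cnormD _ _) (cnormD _ _)) _; rewrite !cnormN.
by move: (i1 L0) (i2 L0) (i3 L0) (i4 L0); gen_cint; clear; lra.
Qed.

Lemma sq_int_split f : cont_on (in_sq x y L) f -> let h := L / 2 in
  sq_int f x y L = sq_int f x y h + sq_int f (x + h) y h
                   + sq_int f x (y + h) h + sq_int f (x + h) (y + h) h.
Proof.
move=> cf h.
have h0 : 0 <= h by exact: divr_ge0.
have hh z : z + h + h = z + L by rewrite /h; field.
have Lx t : x <= t <= x + L -> forall s, y <= s <= y + L -> {for pt t s, continuous f}.
  by move=> tx s sy; apply: cf; split; rewrite ?Re_pt ?Im_pt.
have le1 z : z <= z + h by rewrite lerDl.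
have le2 z : z + h <= z + L by rewrite -hh.
have H s : y <= s <= y + L -> cint (fun t => f (pt t s)) x (x + L) =
   cint (fun t => f (pt t s)) x (x + h) + cint (fun t => f (pt t s)) (x + h) (x + L).
  by move=> sy; apply: cint_split => //; apply: ccont_horizontal => t tx; exact: Lx.
have V s : x <= s <= x + L -> cint (fun t => f (pt s t)) y (y + L) =
   cint (fun t => f (pt s t)) y (y + h) + cint (fun t => f (pt s t)) (y + h) (y + L).
  by move=> sx; apply: cint_split => //; apply: ccont_vertical => t ty; exact: Lx.
by rewrite !sq_intE !hh !H ?V ?lexx ?lerDl ?L0 //; gen_cint; clear; ring.
Qed.

End OnSq.

(** * Bisection and Goursat's theorem *)

Lemma bisection (P : R -> R -> R -> Prop) (x y L : R) : 0 < L ->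
  (forall x y L : R, 0 < L -> let h := L / 2 in
     P x y h -> P (x + h) y h -> P x (y + h) h -> P (x + h) (y + h) h -> P x y L) ->
  (forall p, in_sq x y L p -> exists2 d : R, 0 < d &
     forall x' y' L' : R, 0 < L' < d -> in_sq x' y' L' p -> P x' y' L') ->
  P x y L.
Proof.
move=> L0 Psplit Ploc; apply: contrapT => nP.
(* If [P] fails on a square, it fails on one of the quarters. The resulting nested squares share a
   point, and the local hypothesis at that point contradicts the failure on small squares. *)
pose good (q : R * R * R) := 0 < q.2 /\ ~ P q.1.1 q.1.2 q.2.
have [F HF] : exists F : R * R * R -> R * R * R, forall q, good q ->
    good (F q) /\ [/\ (F q).2 = q.2 / 2, q.1.1 <= (F q).1.1, (F q).1.1 + (F q).2 <= q.1.1 + q.2,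
        q.1.2 <= (F q).1.2 & (F q).1.2 + (F q).2 <= q.1.2 + q.2].
  suff /choice[F HF] : forall q, exists q', good q ->
    good q' /\ [/\ q'.2 = q.2 / 2, q.1.1 <= q'.1.1, q'.1.1 + q'.2 <= q.1.1 + q.2,
        q.1.2 <= q'.1.2 & q'.1.2 + q'.2 <= q.1.2 + q.2] by exists F.
  move=> [[u v] l]; case: (pselect (good (u, v, l))) => [[/= l0 nPq]|ng]; last by exists (u, v, l).
  have h0 : 0 < l / 2 by lra.
  have [|n1] := pselect (P u v (l / 2)); last first.
    by exists (u, v, l / 2) => _; split => //; split=> /=; clear -h0; lra.
  have [|n2] := pselect (P (u + l / 2) v (l / 2)); last first.
    by exists (u + l / 2, v, l / 2) => _; split => //; split=> /=; clear -h0; lra.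
  have [|n3] := pselect (P u (v + l / 2) (l / 2)); last first.
    by exists (u, v + l / 2, l / 2) => _; split => //; split=> /=; clear -h0; lra.
  have [|n4] := pselect (P (u + l / 2) (v + l / 2) (l / 2)); last first.
    by exists (u + l / 2, v + l / 2, l / 2) => _; split => //; split=> /=; clear -h0; lra.
  by move=> p4 p3 p2 p1; case: nPq; exact: Psplit.
pose q n := iter n F (x, y, L).
have gq n : good (q n) by elim: n => [|n /HF[]].
have qL n : (q n).2 = L / 2 ^+ n.
  elim: n => [|n IH]; first by rewrite expr0 divr1.
  have [_ [-> _ _ _ _]] := HF _ (gq n); rewrite IH exprS; field.
  by rewrite expf_neq0.
(* Nested intervals: [g] reads one coordinate of the corner. The lower ends increase and stay below
   every upper end, so their supremum lies in all the intervals. *)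
have nested (g : R * R * R -> R) :
    (forall n, g (q n) <= g (q n.+1) /\ g (q n.+1) + (q n.+1).2 <= g (q n) + (q n).2) ->
    exists p, forall n, g (q n) <= p <= g (q n) + (q n).2.
  move=> Hg.
  have m1 n k : g (q n) <= g (q (n + k)%N).
    elim: k => [|k IH]; first by rewrite addn0.
    by rewrite addnS; apply: le_trans IH (Hg _).1.
  have m2 n k : g (q (n + k)%N) + (q (n + k)%N).2 <= g (q n) + (q n).2.
    elim: k => [|k IH]; first by rewrite addn0.
    by rewrite addnS; apply: le_trans (Hg _).2 IH.
  have m3 n k : g (q n) <= g (q k) + (q k).2.
    have [nk|/ltnW kn] := leqP n k.
      apply: (@le_trans _ _ (g (q k))); first by rewrite -(subnKC nk).
      by rewrite lerDl ltW //; have [] := gq k.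
    apply: le_trans (m2 k (n - k)%N); rewrite subnKC // lerDl ltW //; by have [] := gq n.
  pose A := [set g (q n) | n in [set: nat]].
  have A0 : A !=set0 by exists (g (q 0)), 0%N.
  have Aub k : ubound A (g (q k) + (q k).2) by move=> _ [n _ <-].
  exists (sup A) => n; apply/andP; split; last exact: ge_sup.
  by apply: ub_le_sup; [exists (g (q 0) + (q 0).2); exact: Aub|exists n].
have [px Hpx] : exists p, forall n, (q n).1.1 <= p <= (q n).1.1 + (q n).2.
  by apply: (nested (fun q => q.1.1)) => n; have [_ []] := HF _ (gq n).
have [py Hpy] : exists p, forall n, (q n).1.2 <= p <= (q n).1.2 + (q n).2.
  by apply: (nested (fun q => q.1.2)) => n; have [_ []] := HF _ (gq n).
have inq n : in_sq (q n).1.1 (q n).1.2 (q n).2 (pt px py) by split; rewrite ?Re_pt ?Im_pt.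
have [d d0 Hd] := Ploc _ (inq 0).
(* Since [L / d < n < 2 ^ n], the side [L / 2 ^ n] is less than [d]. *)
pose n := Num.bound (L / d).
have [qn0 nPn] := gq n; apply: nPn; apply: Hd (inq n).
rewrite qn0 qL /= ltr_pdivrMr ?exprn_gt0 // mulrC -ltr_pdivrMr //.
have := archi_boundP (ltW (divr_gt0 L0 d0)); rewrite -/n => /lt_trans; apply.
by rewrite -natrX ltr_nat ltn_expl.
Qed.

Lemma in_sq_dist x y L p w : in_sq x y L p -> in_sq x y L w -> cnorm (w - p) <= 2 * L.
Proof.
move=> [/andP[p1 p2] /andP[p3 p4]] [/andP[w1 w2] /andP[w3 w4]].
apply: le_trans (le_cnorm_ReIm _) _; rewrite cReB cImB.
have : `|cRe w - cRe p| <= L by rewrite ler_norml; apply/andP; split; lra.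
have : `|cIm w - cIm p| <= L by rewrite ler_norml; apply/andP; split; lra.
lra.
Qed.

Lemma bounded_in_sq f (x y L : R) : 0 < L -> cont_on (in_sq x y L) f ->
  exists M : R, forall w, in_sq x y L w -> cnorm (f w) <= M.
Proof.
move=> L0 cf.
suff [M HM] : exists M : R, forall w, in_sq x y L w -> in_sq x y L w -> cnorm (f w) <= M.
  by exists M => w win; exact: HM.
apply: (@bisection (fun x' y' L' => exists M : R, forall w,
  in_sq x' y' L' w -> in_sq x y L w -> cnorm (f w) <= M)) => //.
  move=> x' y' L' L'0 h [M1 H1] [M2 H2] [M3 H3] [M4 H4].
  exists (Num.max (Num.max M1 M2) (Num.max M3 M4)) => w [/andP[w1 w2] /andP[w3 w4]] win.
  have eL : L' = h + h by rewrite /h; field.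
  rewrite !le_max; case: (leP (cRe w) (x' + h)) => [u1|/ltW u1];
    case: (leP (cIm w) (y' + h)) => [v1|/ltW v1].
  - rewrite H1 //; split; apply/andP; split; lra.
  - rewrite H3 ?orbT //; split; apply/andP; split; lra.
  - rewrite H2 ?orbT //; split; apply/andP; split; lra.
  - rewrite H4 ?orbT //; split; apply/andP; split; lra.
move=> q qin; have := (continuousP_cnorm f q).1 (cf _ qin) 1 ltr01.
move=> /nbhs_cnormP[d d0 Hd]; exists (d / 2) => [|x' y' L' /andP[L'0 L'd] qin'].
  exact: divr_gt0.
exists (cnorm (f q) + 1) => w win' _.
have wd : cnorm (w - q) < d.
  by apply: le_lt_trans (in_sq_dist qin' win') _; rewrite mulrC -ltr_pdivlMr.
have := cnormD (f w - f q) (f q); rewrite subrK; have := Hd _ wd; lra.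
Qed.

(* [corner_mass px py] is additive under the bisection of a square, and is at
   least [L] on every square of side [L] containing [px + i py]: it makes the
   bisection argument in [goursat] work at one point of mere continuity. *)
Definition sgsqrt (t : R) := Num.sg t * Num.sqrt `|t|.

Lemma sgsqrt_le a b : a <= b -> sgsqrt a <= sgsqrt b.
Proof.
rewrite /sgsqrt => ab; have sa := sqrtr_ge0 `|a|; have sb := sqrtr_ge0 `|b|.
have [a0|a0|a0] := ltgtP a 0; have [b0|b0|b0] := ltgtP b 0;
  rewrite ?(ltr0_sg a0) ?(gtr0_sg a0) ?(ltr0_sg b0) ?(gtr0_sg b0) ?a0 ?b0 ?sgr0; try lra.
- rewrite !mulN1r lerN2 ler_wsqrtr // !ltr0_norm //; lra.
- by rewrite !mul1r ler_wsqrtr // !gtr0_norm.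
Qed.

(** The right-hand side is [sqrt (a + L) + sqrt (- a)], whose square is at least
    [(a + L) + (- a)]. *)
Lemma sgsqrt_ge a L : a <= 0 <= a + L -> Num.sqrt L <= sgsqrt (a + L) - sgsqrt a.
Proof.
move=> /andP[a0 b0]; rewrite /sgsqrt.
have -> : Num.sg (a + L) * Num.sqrt `|a + L| = Num.sqrt (a + L).
  by move: b0; rewrite le_eqVlt => /orP[/eqP<-|b0]; rewrite ?sgr0 ?sqrtr0 ?mul0r // gtr0_sg ?gtr0_norm ?mul1r.
have -> : Num.sg a * Num.sqrt `|a| = - Num.sqrt (- a).
  move: a0; rewrite le_eqVlt => /orP[/eqP->|a0]; rewrite ?oppr0 ?sgr0 ?sqrtr0 ?mul0r ?oppr0 //.
  by rewrite ltr0_sg ?ltr0_norm ?mulN1r.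
rewrite opprK -(@ler_pXn2r _ 2) ?nnegrE ?addr_ge0 ?sqrtr_ge0 //.
rewrite sqrrD !sqr_sqrtr //; last 2 first; try lra.
by have := mulr_ge0 (sqrtr_ge0 (a + L)) (sqrtr_ge0 (- a)); lra.
Qed.

Definition corner_mass (px py x y L : R) :=
  (sgsqrt (x + L - px) - sgsqrt (x - px)) * (sgsqrt (y + L - py) - sgsqrt (y - py)).

Definition has_cderiv (f : C -> C) (p : C) := exists c : C, forall e : R, 0 < e ->
  exists2 d : R, 0 < d & forall w, cnorm (w - p) < d ->
    cnorm (f w - f p - c * (w - p)) <= e * cnorm (w - p).

(** The bound [e * (L ^ 2 + corner_mass)] is additive under bisection. At a point of
    differentiability the affine part integrates to zero and the remainder is at most [e L ^ 2]; at
    [p] continuity yields only [e L], which the mass absorbs. *)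
Lemma goursat f (x y L : R) p : 0 < L -> cont_on (in_sq x y L) f ->
  (forall w, in_sq x y L w -> w <> p -> has_cderiv f w) -> sq_int f x y L = 0.
Proof.
move=> L0 cf df.
pose m := corner_mass (cRe p) (cIm p).
have m0 x' y' L' : 0 < L' -> 0 <= m x' y' L'.
  by move=> h; apply: mulr_ge0; rewrite subr_ge0 sgsqrt_le //; lra.
suff H (e : R) : 0 < e -> cnorm (sq_int f x y L) <= e * (L ^+ 2 + m x y L).
  apply/eqP; rewrite -cnorm_eq0 eq_le cnorm_ge0 andbT; apply/ler_addgt0Pl => /= e e0; rewrite addr0.
  pose M := L ^+ 2 + m x y L + 1.
  have M0 : 0 < M by have := m0 x y L L0; have := sqr_ge0 L; rewrite /M; lra.
  apply: le_trans (H (e / M) (divr_gt0 e0 M0)) _.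
  rewrite -mulrA ler_piMr ?(ltW e0) // mulrC ler_pdivrMr // mul1r /M; lra.
move=> e0.
(* A small square containing a given point may leave the original square, where nothing is known of
   [f]; the bisected statement is therefore conditional on [sub]. *)
pose sub (x' y' L' : R) := [/\ x <= x', x' + L' <= x + L, y <= y' & y' + L' <= y + L].
have subin (x' y' L' : R) w : sub x' y' L' -> in_sq x' y' L' w -> in_sq x y L w.
  by case=> ? ? ? ? [/andP[? ?] /andP[? ?]]; split; apply/andP; split; lra.
suff : sub x y L -> cnorm (sq_int f x y L) <= e * (L ^+ 2 + m x y L).
  by apply; split.
apply: (@bisection (fun x y L => sub x y L -> cnorm (sq_int f x y L) <= e * (L ^+ 2 + m x y L))) => //.
  move=> x' y' L' L'0 h H1 H2 H3 H4 s.
  have [s1 s2 s3 s4] := s; have h0 : 0 < h by exact: divr_gt0.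
  have eL : L' = h + h by rewrite /h; field.
  have cf' : cont_on (in_sq x' y' L') f by move=> w /(subin _ _ _ _ s)/cf.
  rewrite (sq_int_split (ltW L'0) cf') -/h.
  apply: le_trans (cnormD _ _) _; apply: le_trans (lerD (cnormD _ _) (lexx _)) _.
  apply: le_trans (lerD (lerD (cnormD _ _) (lexx _)) (lexx _)) _.
  have em : L' ^+ 2 + m x' y' L' = (h ^+ 2 + m x' y' h) + (h ^+ 2 + m (x' + h) y' h)
      + (h ^+ 2 + m x' (y' + h) h) + (h ^+ 2 + m (x' + h) (y' + h) h).
    by rewrite /m /corner_mass eL !addrA; ring.
  rewrite em (mulrDr e (_ + _ + _)) (mulrDr e (_ + _)) (mulrDr e); apply: lerD; [apply: lerD; [apply: lerD|]|].
  - by apply: H1; rewrite /sub; clear -s1 s2 s3 s4 h0 eL; split; lra.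
  - by apply: H2; rewrite /sub; clear -s1 s2 s3 s4 h0 eL; split; lra.
  - by apply: H3; rewrite /sub; clear -s1 s2 s3 s4 h0 eL; split; lra.
  - by apply: H4; rewrite /sub; clear -s1 s2 s3 s4 h0 eL; split; lra.
move=> q qin.
have cfs (x' y' L' : R) : 0 < L' -> sub x' y' L' -> cont_on (on_sq x' y' L') f.
  by move=> _ s w [/(subin _ _ _ _ s)/cf].
have cb (a b : C) w : {for w, continuous (fun w => a + b * w : C)}.
  by apply: (@continuousD _ _ _ (cst a) (fun w => b * w)); [exact: cst_continuous|exact: mulrl_continuous].
have approx (a b : C) (x' y' L' M : R) : 0 < L' -> sub x' y' L' ->
   (forall w, in_sq x' y' L' w -> cnorm (f w - (a + b * w)) <= M) ->
   cnorm (sq_int f x' y' L') <= 8 * M * L'.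
  move=> L'0 s fM; have L'1 := ltW L'0.
  rewrite -[sq_int _ _ _ _]subr0 -(sq_int_affine x' y' L'1 a b) -sq_intB //; last exact: cfs.
  apply: sq_int_norm_le => // [w|w [/fM]//] wsq.
  by apply: (@continuousB _ _ _ f (fun w => a + b * w)) => //; exact: (cfs _ _ _ L'0 s).
have [qp|/eqP qp] := eqVneq q p.
  (* The [8] offsets the constant of [sq_int_norm_le]. *)
  have := (continuousP_cnorm f q).1 (cf _ qin) (e / 8).
  rewrite divr_gt0 // => /(_ isT)/nbhs_cnormP[d d0 Hd].
  exists (d / 2) => [|x' y' L' /andP[L'0 L'd] qin' s]; first exact: divr_gt0.
  apply: (@le_trans _ _ (8 * (e / 8) * L')).
    apply: (approx (f q) 0) => // w win; rewrite mul0r addr0 ltW //; apply: Hd.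
    by apply: le_lt_trans (in_sq_dist qin' win) _; rewrite mulrC -ltr_pdivlMr.
  rewrite (_ : 8 * (e / 8) = e); last by field.
  rewrite ler_pM2l // -[leLHS]add0r lerD ?sqr_ge0 //.
  rewrite -[leLHS](sqr_sqrtr (ltW L'0)) expr2 /m /corner_mass.
  case: qin'; rewrite qp => /andP[p1 p2] /andP[p3 p4].
  rewrite (addrAC x' L') (addrAC y' L'); apply: ler_pM; rewrite ?sqrtr_ge0 //.
    by apply: sgsqrt_ge; clear -p1 p2; lra.
  by apply: sgsqrt_ge; clear -p3 p4; lra.
(* Here [16] is that [8] times the [2] of [in_sq_dist]. *)
have [c /(_ (e / 16))] := df _ qin qp.
rewrite divr_gt0 // => /(_ isT)[d d0 Hd].
exists (d / 2) => [|x' y' L' /andP[L'0 L'd] qin' s]; first exact: divr_gt0.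
apply: (@le_trans _ _ (8 * (e / 16 * (2 * L')) * L')).
  apply: (approx (f q - c * q) c) => // w win.
  have wq := in_sq_dist qin' win.
  rewrite (_ : f w - _ = f w - f q - c * (w - q)); last by clear; ring.
  apply: le_trans (Hd _ _) _; last by rewrite ler_pM2l ?divr_gt0.
  by apply: le_lt_trans wq _; rewrite mulrC -ltr_pdivlMr.
rewrite (_ : 8 * _ * _ = e * L' ^+ 2); last by field.
by rewrite ler_pM2l // lerDl m0.
Qed.

(** * Cauchy's formula and division by powers *)

Lemma has_cderivP (f : C -> C) (p : C) : derivable f p 1 <-> has_cderiv f p.
Proof.
split=> [/cvg_ex[c Hc]|[c H]].
  have H := (cvgrPdist_lt _ _).1 Hc.
  exists c => e e0; have e0' : 0 < toC e by rewrite -toC0 ltc_toC.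
  have FF : Filter (0 : C)^' by apply: within_filter.
  have := H FF (toC e) e0'; rewrite near_withinE => /nbhs_cnormP[d d0 Hd]; exists d => // w wd.
  have [->|wp] := eqVneq w p; first by rewrite !subrr mulr0 subr0 cnorm0 mulr0.
  have wp0 : w - p != 0 by rewrite subr_eq0.
  have := Hd (w - p); rewrite subr0 => /(_ wd wp0).
  rewrite /= distrC ltr_cnorm => /ltW; rewrite -(ler_pM2r (x := cnorm (w - p))) ?cnorm_gt0 // -cnormM.
  congr (cnorm _ <= _); rewrite /GRing.scale /= mulr1 subrK mulrBl mulrAC mulVf // mul1r.
  by rewrite mulrC.
apply/cvg_ex; exists c; apply/cvgrPdist_lt => _/gt0_toC[e e0 ->].
have [d d0 Hd] := H (e / 2) (divr_gt0 e0 (ltr0Sn _ _)).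
rewrite near_withinE; apply/nbhs_cnormP; exists d => // h; rewrite subr0 => hd h0.
rewrite ltr_cnorm cnormB.
have := Hd (p + h); rewrite addrAC subrr add0r => /(_ hd).
rewrite -ler_pdivrMr ?cnorm_gt0 // -cnormV -cnormM.
rewrite (_ : _ / h = h^-1 *: ((f \o shift p) h%:A - f p) - c) => [/le_lt_trans|]; first by apply; lra.
by rewrite /= /GRing.scale /= mulr1 (addrC h) mulrBl mulfK // [in RHS]mulrC.
Qed.

Lemma has_cderiv_continuous f p : has_cderiv f p -> {for p, continuous f}.
Proof. by move=> /has_cderivP/derivable1_diffP; exact: differentiable_continuous. Qed.

Lemma has_cderiv_near f g p : (\forall w \near p, f w = g w) -> has_cderiv f p -> has_cderiv g p.
Proof.
move=> /nbhs_cnormP[d d0 fg] [c H]; exists c => e /H[d' d'0 H'].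
exists (Num.min d d') => [|w]; first by rewrite lt_min d0.
rewrite lt_min => /andP[wd wd']; rewrite -!fg //; first exact: H'.
by rewrite subrr cnorm0.
Qed.

Section Cauchy.
Variables (a : C) (r : R).
Hypothesis r0 : 0 < r.
Let x := cRe a - r.
Let y := cIm a - r.
Let L := 2 * r.

Lemma side_gt0 : 0 < L. Proof. by rewrite /L mulr_gt0. Qed.
Lemma side_ge0 : 0 <= L. Proof. exact: ltW side_gt0. Qed.

(** Points of this disc stay at distance at least [r / 2] from the boundary of the square, which
    bounds [1 / (w - z)] uniformly. *)
Let near_a z := cnorm (z - a) <= r / 2.

Lemma far_boundary w : on_sq x y L w -> r <= cnorm (w - a).
Proof.
case=> _ h; have : r <= `|cRe (w - a)| \/ r <= `|cIm (w - a)|.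
  rewrite cReB cImB; case: h; rewrite /x /y /L => ->; [left|left|right|right];
   rewrite ler_normr; apply/orP; [right|left|right|left]; lra.
by case=> /le_trans; apply; [exact: ge_cnorm_Re|exact: ge_cnorm_Im].
Qed.

Lemma far_near z w : near_a z -> on_sq x y L w -> r / 2 <= cnorm (w - z).
Proof.
move=> za /far_boundary wa; have := cnormD (w - z) (z - a); rewrite subrKA.
by move: za; rewrite /near_a; lra.
Qed.

Lemma neq_near z w : near_a z -> on_sq x y L w -> w - z != 0.
Proof. by move=> za /(far_near za) h; rewrite -cnorm_gt0; apply: lt_le_trans h; rewrite divr_gt0. Qed.

Lemma near_center : near_a a.
Proof. by rewrite /near_a subrr cnorm0 divr_ge0 // ltW. Qed.

(* Not normalized by [2 pi i]: only [Im (cauchy_int 1 a) > 0] is needed. *)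
Definition cauchy_int (k : C -> C) (z : C) := sq_int (fun w => k w / (w - z)) x y L.

(** The bound is carried along because it survives division by [w - a], which the expansion at [a]
    repeats. *)
Definition kernel (k : C -> C) := cont_on (on_sq x y L) k /\
  exists M : R, forall w, on_sq x y L w -> cnorm (k w) <= M.

Lemma cont_div k z : near_a z -> cont_on (on_sq x y L) k ->
  cont_on (on_sq x y L) (fun w => k w / (w - z)).
Proof.
move=> za ck w wsq; apply: (@continuousM C C k (fun w => (w - z)^-1)); first exact: ck.
apply: (@continuousV C C (fun w => w - z)); first exact: neq_near wsq.
by apply: (@continuousB _ _ _ id (cst z)); [exact: cvg_id|exact: cst_continuous].
Qed.

Lemma kernel_div k : kernel k -> kernel (fun w => k w / (w - a)).
Proof.
move=> [ck [M kM]]; split; first exact: cont_div near_center ck.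
exists (M / r) => w wsq; rewrite cnormM cnormV ler_pM ?invr_ge0 ?cnorm_ge0 ?kM //.
by rewrite lef_pV2 ?posrE ?far_boundary //; apply: lt_le_trans r0 (far_boundary wsq).
Qed.

Lemma cauchy_int_bounded k : kernel k -> exists2 M : R, 0 <= M &
  forall z, near_a z -> cnorm (cauchy_int k z) <= M.
Proof.
move=> [ck [M kM]]; exists (8 * (`|M| / (r / 2)) * L) => [|z za].
  by apply: mulr_ge0 side_ge0; apply: mulr_ge0 => //; apply: divr_ge0 => //; apply: divr_ge0 => //; exact: ltW.
apply: (sq_int_norm_le side_ge0 (cont_div za ck)) => w wsq.
rewrite cnormM cnormV ler_pM ?invr_ge0 ?cnorm_ge0 //.
  by apply: le_trans (kM _ wsq) _; exact: ler_norm.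
have r20 : 0 < r / 2 by rewrite divr_gt0.
by rewrite lef_pV2 ?posrE ?far_near //; exact: lt_le_trans r20 (far_near za wsq).
Qed.

(** Integrated form of [1 / (w - z) - 1 / (w - a) = (z - a) / ((w - a) (w - z))]. *)
Lemma cauchy_int_diff k z : kernel k -> near_a z ->
  cauchy_int k z = cauchy_int k a + (z - a) * cauchy_int (fun w => k w / (w - a)) z.
Proof.
move=> kk za; have [ck _] := kk; have [ck1 _] := kernel_div kk.
rewrite /cauchy_int -(sq_intZ side_ge0 (z - a) (cont_div za ck1)).
apply/eqP; rewrite addrC -subr_eq -(sq_intB side_ge0 (cont_div za ck) (cont_div near_center ck)).
apply/eqP; apply: (eq_sq_int side_ge0) => w wsq.
by have := neq_near za wsq; have := neq_near near_center wsq; move: (k w) => kw h1 h2; field; rewrite h1 h2.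
Qed.

Lemma cauchy_int_continuous k : kernel k -> {for a, continuous (cauchy_int k)}.
Proof.
move=> kk; have [M M0 HM] := cauchy_int_bounded (kernel_div kk).
apply/continuousP_cnorm => e e0; apply/nbhs_cnormP.
exists (Num.min (r / 2) (e / (M + 1))) => [|w].
  by rewrite lt_min !divr_gt0 //; lra.
rewrite lt_min => /andP[/ltW wa we]; rewrite cauchy_int_diff // addrAC subrr add0r cnormM.
move: we; rewrite ltr_pdivlMr; last by lra.
apply: le_lt_trans; rewrite ler_pM ?cnorm_ge0 //; apply: le_trans (HM _ wa) _; lra.
Qed.

(** A bound of positive order forces [cauchy_int k a = 0]; then [cauchy_int_diff] splits off one
    factor [z - a], and the remaining Cauchy integral satisfies the bound of one order less. *)
Lemma cauchy_int_order k d : kernel k ->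
  (exists2 K : R, 0 <= K & exists2 delta : R, 0 < delta & forall z, z != a -> cnorm (z - a) < delta ->
      cnorm (cauchy_int k z) <= K * cnorm (z - a) ^+ d) ->
  exists2 k', kernel k' & forall z, near_a z -> cauchy_int k z = (z - a) ^+ d * cauchy_int k' z.
Proof.
elim: d k => [|d IH] k kk [K K0 [delta delta0 kO]].
  by exists k => // z za; rewrite expr0 mul1r.
have kk1 := kernel_div kk.
have [M M0 HM] := cauchy_int_bounded kk1.
have ka0 : cauchy_int k a = 0.
  apply/eqP; rewrite -cnorm_eq0 eq_le cnorm_ge0 andbT; apply/ler_addgt0Pl => /= e e0; rewrite addr0.
  (* At the test point [a + t] the bound on [cauchy_int k] and [cauchy_int_diff] give [|cauchy_int k
     a| <= K t ^ (d + 1) + t M <= t (K + M + 1) <= e]. *)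
  pose t := Num.min (Num.min 1 (delta / 2)) (Num.min (r / 2) (e / (K + M + 1))).
  have t0 : 0 < t by rewrite !lt_min !divr_gt0 //; lra.
  have t1 : t <= 1 by rewrite !ge_min lexx.
  have t2 : t < delta by apply: (@le_lt_trans _ _ (delta / 2)); [rewrite !ge_min lexx ?orbT|lra].
  have t3 : t <= r / 2 by rewrite !ge_min lexx ?orbT.
  have t4 : t * (K + M + 1) <= e.
    by rewrite -ler_pdivlMr; [rewrite !ge_min lexx ?orbT|lra].
  have nt : cnorm (a + toC t - a) = t by rewrite addrAC subrr add0r cnorm_toC gtr0_norm.
  have za : near_a (a + toC t) by rewrite /near_a nt.
  have tn : a + toC t != a by rewrite -subr_eq0 -cnorm_gt0 nt.
  have := kO _ tn; rewrite nt => /(_ t2) h1.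
  have h2 := cauchy_int_diff kk za; have h3 := HM _ za.
  have -> : cauchy_int k a = cauchy_int k (a + toC t)
      - (a + toC t - a) * cauchy_int (fun w => k w / (w - a)) (a + toC t).
    by rewrite h2; ring.
  apply: le_trans (cnormD _ _) _; rewrite cnormN cnormM nt.
  apply: le_trans (lerD h1 (ler_wpM2l (ltW t0) h3)) _.
  apply: le_trans t4; rewrite mulrDr mulrDr mulr1.
  have : K * t ^+ d.+1 <= t * K.
    rewrite mulrC ler_wpM2r // exprS ler_piMr ?(ltW t0) // exprn_ile1 //; exact: ltW.
  lra.
have [|k' kk' Hk'] := IH _ kk1.
  exists K => //; exists (Num.min delta (r / 2)) => [|z zna].
    by rewrite lt_min delta0 divr_gt0.
  rewrite lt_min => /andP[zd /ltW za]; have := kO z zna zd.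
  rewrite cauchy_int_diff // ka0 add0r cnormM exprS mulrCA ler_pM2l //.
  by rewrite cnorm_gt0 subr_eq0.
by exists k' => // z za; rewrite cauchy_int_diff // ka0 add0r Hk' // exprS mulrA.
Qed.

Lemma kernel1 : kernel (fun=> 1).
Proof.
split; first by move=> w _; exact: cst_continuous.
by exists 1 => w _; rewrite -toC1 cnorm_toC normr1.
Qed.

(** On each side, with [s] in [[- r, r]], the imaginary part of [dw / (w - a)] is
    [r / (s ^ 2 + r ^ 2) ds], at least [ds / (2 r)]; so each of the four sides contributes at least
    [1]. *)
Lemma Im_cauchy_int1 : 0 < cIm (cauchy_int (fun=> 1) a).
Proof.
have [ck _] := kernel1.
have [|c1 c2 c3 c4] := on_sq_ccont side_ge0 (f := fun w => 1 / (w - a)) (x := x) (y := y).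
  exact: cont_div near_center ck.
have cZ (c : C) u b b' : ccont u b b' -> ccont (fun t => c * u t) b b'.
  by move=> cu t tb; apply: (@continuous_comp _ _ _ u (fun z => c * z)); [exact: cu|exact: mulrl_continuous].
rewrite /cauchy_int sq_intE.
(* Signs and factors [i] move under the integrals, so that every integrand has positive imaginary
   part. *)
rewrite -[X in _ - X + _]mul1r -mulNr -(cintZ (- 1) c2) mulrBr -mulNr -(cintZ ci c4) -(cintZ (- ci) c3).
have ImD (u v : C) : cIm (u + v) = cIm u + cIm v by case: u => ? ?; case: v.
rewrite !ImD.
have e2 (z : R) : z <= z + L by rewrite lerDl; exact: side_ge0.
have key (s : R) : - r <= s <= r -> (2 * r)^-1 <= r / (s ^+ 2 + r ^+ 2).
  move=> /andP[s1 s2].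
  have sr : s ^+ 2 <= r ^+ 2 by rewrite -subr_ge0 subr_sqr; apply: mulr_ge0; lra.
  rewrite ler_pdivlMr; last by have := exprn_gt0 2 r0; have := sqr_ge0 s; lra.
  rewrite ler_pdivrMl ?mulr_gt0 // -mulrA -expr2; lra.
pose m := (2 * r)^-1.
have ptE (u v : R) : pt u v = (u +i* v)%C.
  by apply/eqP; rewrite /pt /toC /ci eq_complex /=; apply/andP; split; apply/eqP; ring.
have Iinv (u v : R) : cIm (1 / pt u v) = - (v / (u ^+ 2 + v ^+ 2)) by rewrite mul1r ptE.
have Rinv (u v : R) : cRe (1 / pt u v) = u / (u ^+ 2 + v ^+ 2) by rewrite mul1r ptE.
have ptB (s t : R) : pt s t - a = pt (s - cRe a) (t - cIm a).
  by rewrite {1}[a]cReIm /pt !toCB; ring.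
have ImN (u : C) : cIm (- 1 * u) = - cIm u by rewrite mulN1r; case: u.
have Imi (u : C) : cIm (ci * u) = cRe u by rewrite mulrC; exact: ImiRe.
have yl : y - cIm a = - r by rewrite /y; ring.
have yr : y + L - cIm a = r by rewrite /y /L; ring.
have xl : x - cRe a = - r by rewrite /x; ring.
have xr : x + L - cRe a = r by rewrite /x /L; ring.
have tx (t : R) : x <= t <= x + L -> - r <= t - cRe a <= r.
  by rewrite /x /L => /andP[h1 h2]; apply/andP; split; lra.
have ty (t : R) : y <= t <= y + L -> - r <= t - cIm a <= r.
  by rewrite /y /L => /andP[h1 h2]; apply/andP; split; lra.
have i1 : m * (x + L - x) <= cIm (cint (fun t => 1 / (pt t y - a)) x (x + L)).
  apply: (cint_Im_ge (e2 x) c1) => t /tx ts; rewrite ptB Iinv yl sqrrN mulNr opprK; exact: key.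
have i2 : m * (x + L - x) <= cIm (cint (fun t => - 1 * (1 / (pt t (y + L) - a))) x (x + L)).
  apply: (cint_Im_ge (e2 x) (cZ (- 1) _ _ _ c2)).
  by move=> t /tx ts; rewrite ImN ptB Iinv yr opprK; exact: key.
have i3 : m * (y + L - y) <= cIm (cint (fun t => ci * (1 / (pt (x + L) t - a))) y (y + L)).
  apply: (cint_Im_ge (e2 y) (cZ (ci) _ _ _ c4)).
  by move=> t /ty ts; rewrite Imi ptB Rinv xr addrC; exact: key.
have i4 : m * (y + L - y) <= cIm (cint (fun t => - ci * (1 / (pt x t - a))) y (y + L)).
  apply: (cint_Im_ge (e2 y) (cZ (- ci) _ _ _ c3)).
  move=> t /ty ts; rewrite -mulN1r -mulrA ImN Imi ptB Rinv xl sqrrN mulNr opprK addrC; exact: key.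
have mL (z : R) : m * (z + L - z) = 1.
  by rewrite addrAC subrr add0r /m /L mulVf // mulf_neq0 // gt_eqF.
by move: i1 i2 i3 i4; rewrite !mL; gen_cint; lra.
Qed.

(** Goursat's theorem applied to the difference quotient of [f] at [z], completed by the derivative:
    it is continuous at [z] and differentiable elsewhere, which is the exception that [goursat]
    allows. *)
Lemma cauchy_formula f z : (forall w, in_sq x y L w -> has_cderiv f w) -> near_a z ->
  f z * cauchy_int (fun=> 1) z = cauchy_int f z.
Proof.
move=> df za.
have zin : in_sq x y L z.
  have := le_trans (ge_cnorm_Re (z - a)) za; have := le_trans (ge_cnorm_Im (z - a)) za.
  rewrite cReB cImB !ler_norml => /andP[h1 h2] /andP[h3 h4].
  by split; apply/andP; rewrite /x /y /L; split; lra.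
have [c Hc] := df _ zin.
pose h w := if w == z then c else (f w - f z) / (w - z).
have dh w : in_sq x y L w -> w <> z -> has_cderiv h w.
  move=> win /eqP wz; have wz0 : w - z != 0 by rewrite subr_eq0.
  apply: (@has_cderiv_near (fun w => (f w - f z) * (w - z)^-1)).
    apply/nbhs_cnormP; exists (cnorm (w - z)) => [|v vw]; first by rewrite cnorm_gt0.
    by rewrite /h; case: eqP vw => // ->; rewrite cnormB ltxx.
  apply/has_cderivP; apply: derivableM.
    by apply: derivableB; [apply/has_cderivP/df|exact: derivable_cst].
  by apply: (@derivableV _ _ (fun w => w - z)) => //; apply: derivableB.
have ch : cont_on (in_sq x y L) h.
  move=> w win; have [->|/eqP wz] := eqVneq w z; last exact/has_cderiv_continuous/dh.
  apply/continuousP_cnorm => e e0; apply/nbhs_cnormP.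
  have [d d0 Hd] := Hc (e / 2) (divr_gt0 e0 (ltr0Sn _ _)); exists d => // v vd.
  rewrite /h eqxx; case: eqVneq => [_|vz]; first by rewrite subrr cnorm0.
  have vz0 : v - z != 0 by rewrite subr_eq0.
  rewrite (_ : _ - c = (f v - f z - c * (v - z)) / (v - z)); last by field.
  rewrite cnormM cnormV ltr_pdivrMr ?cnorm_gt0 //; apply: le_lt_trans (Hd _ vd) _.
  by rewrite ltr_pM2r ?cnorm_gt0 //; lra.
have cf : cont_on (on_sq x y L) f by move=> w [/df/has_cderiv_continuous].
have := goursat side_gt0 ch dh.
rewrite (@eq_sq_int _ _ _ side_ge0 _ (fun w => f w / (w - z) - f z * (1 / (w - z)))); last first.
  move=> w wsq; have := neq_near za wsq; rewrite /h subr_eq0 => /negbTE ->.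
  by rewrite mulrBl mul1r.
have c1 : cont_on (on_sq x y L) (fun w => 1 / (w - z)).
  exact: cont_div za kernel1.1.
have c2 : cont_on (on_sq x y L) (fun w => f z * (1 / (w - z))).
  move=> w wsq; apply: (@continuous_comp _ _ _ (fun w => 1 / (w - z)) (fun v => f z * v)); first exact: c1.
  exact: mulrl_continuous.
rewrite (sq_intB side_ge0 (cont_div za cf) c2) (sq_intZ side_ge0 _ c1).
by move=> /eqP; rewrite subr_eq0 => /eqP e; rewrite /cauchy_int [RHS]e.
Qed.

End Cauchy.

(** Near [a] Cauchy's formula writes [f] as a quotient of two Cauchy integrals. The order of [f]
    passes to the numerator, from which [cauchy_int_order] extracts [(z - a) ^ d]; what is left is
    continuous at [a]. *)
Lemma removable_quotient (f : C -> C) (a : C) (d : nat) :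
  (\forall z \near a, derivable f z 1) ->
  (exists2 K : R, 0 <= K & \forall z \near a, z != a -> cnorm (f z) <= K * cnorm (z - a) ^+ d) ->
  cvg (f z / (z - a) ^+ d @[z --> a^']).
Proof.
move=> /nbhs_cnormP[d1 d10 df] [K K0 /nbhs_cnormP[d2 d20 fO]].
(* The square of half-side [r] lies within distance [2 r] of [a], less than both radii. *)
pose r := Num.min d1 d2 / 4.
have m0 : 0 < Num.min d1 d2 by rewrite lt_min d10.
have r0 : 0 < r by rewrite divr_gt0.
have [rd1 rd2] : 2 * r < d1 /\ 2 * r < d2.
  have : Num.min d1 d2 <= d1 by rewrite ge_min lexx.
  have : Num.min d1 d2 <= d2 by rewrite ge_min lexx orbT.
  by move: m0; rewrite /r; split; lra.
have df' w : in_sq (cRe a - r) (cIm a - r) (2 * r) w -> has_cderiv f w.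
  move=> [/andP[w1 w2] /andP[w3 w4]]; apply/has_cderivP/df.
  apply: le_lt_trans rd1; apply: le_trans (le_cnorm_ReIm _) _; rewrite cReB cImB.
  have : `|cRe w - cRe a| <= r by rewrite ler_norml; apply/andP; split; lra.
  have : `|cIm w - cIm a| <= r by rewrite ler_norml; apply/andP; split; lra.
  lra.
have fk : kernel a r f.
  split; first by move=> w [/df'/has_cderiv_continuous].
  have [||M HM] := @bounded_in_sq f (cRe a - r) (cIm a - r) (2 * r).
  - by rewrite mulr_gt0.
  - by move=> w /df'/has_cderiv_continuous.
  - by exists M => w [/HM].
have J0 : cauchy_int a r (fun=> 1) a != 0.
  by apply/eqP => J; have := Im_cauchy_int1 a r0; rewrite J ltxx.
have cJ := cauchy_int_continuous r0 (kernel1 a r).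
have [e e0 Je] : exists2 e : R, 0 < e & forall z, cnorm (z - a) < e -> cauchy_int a r (fun=> 1) z != 0.
  have J1 : 0 < cnorm (cauchy_int a r (fun=> 1) a) by rewrite cnorm_gt0.
  have /nbhs_cnormP[e e0 He] := (continuousP_cnorm _ _).1 cJ _ J1.
  exists e => // z /He; apply: contraTneq => ->; rewrite sub0r cnormN ltxx //.
have r20 : 0 < r / 2 by rewrite divr_gt0.
have [N N0 JN] := cauchy_int_bounded r0 (kernel1 a r).
have [|k' kk' Hk'] := @cauchy_int_order a r r0 f d fk.
  exists (K * N); first exact: mulr_ge0.
  exists (Num.min (r / 2) d2) => [|z za]; first by rewrite lt_min r20.
  rewrite lt_min => /andP[/ltW zr zd].
  rewrite -(cauchy_formula r0 df' zr) cnormM mulrAC.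
  by apply: ler_pM; rewrite ?cnorm_ge0 ?fO ?JN.
have cK := cauchy_int_continuous r0 kk'.
apply/cvg_ex; exists (cauchy_int a r k' a / cauchy_int a r (fun=> 1) a).
apply: (@cvg_trans _ ((fun z => cauchy_int a r k' z / cauchy_int a r (fun=> 1) z) @ a^')).
  apply: near_eq_cvg; rewrite near_withinE; apply/nbhs_cnormP.
  exists (Num.min (r / 2) e) => [|z]; first by rewrite lt_min r20.
  rewrite lt_min => /andP[/ltW zr ze] za.
  have J1 := Je _ ze; have za0 : (z - a) ^+ d != 0 by rewrite expf_neq0 // subr_eq0.
  apply: (mulIf J1); rewrite divfK // mulrAC (cauchy_formula r0 df' zr) (Hk' _ zr).
  by rewrite mulrAC divff // mul1r.
apply: cvg_within_filter.
apply: (@continuousM C C (cauchy_int a r k') (fun z => (cauchy_int a r (fun=> 1) z)^-1)); first exact: cK.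
exact: (@continuousV C C (cauchy_int a r (fun=> 1)) a J0 cJ).
Qed.


End ComplexAnalysis.
(** * Partial fractions and the cyclic model *)

Section PartialFractions.
Variables (F : fieldType) (s : nat) (m : 'I_s -> nat) (lam : 'I_s -> F).
Hypothesis lam_inj : injective lam.

Definition root_poly : {poly F} := \prod_(j < s) ('X - (lam j)%:P) ^+ m j.
Definition co_root_poly (j : 'I_s) : {poly F} := \prod_(l < s | l != j) ('X - (lam l)%:P) ^+ m l.
(** This is [p^(a)(c) / a!], obtained without division. *)
Definition taylor_coef (c : F) (p : {poly F}) (a : nat) : F := (p \Po ('X + c%:P))`_a.

Lemma root_polyE j : root_poly = ('X - (lam j)%:P) ^+ m j * co_root_poly j.
Proof. by rewrite /root_poly (bigD1 j). Qed.

Lemma dvdp_taylor_rem (c : F) (p : {poly F}) (k : nat) :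
  ('X - c%:P) ^+ k %| p - \sum_(a < k) taylor_coef c p a *: ('X - c%:P) ^+ a.
Proof.
pose q := p \Po ('X + c%:P).
have eq_p : p = q \Po ('X - c%:P) by rewrite comp_polyXaddC_K.
have -> : \sum_(a < k) taylor_coef c p a *: ('X - c%:P) ^+ a = take_poly k q \Po ('X - c%:P).
  rewrite [take_poly _ _]poly_def raddf_sum /=; apply: eq_bigr => a _.
  by rewrite comp_polyZ comp_Xn_poly.
rewrite [X in _ %| X - _]eq_p -comp_polyB -{1}(poly_take_drop k q) addrAC subrr add0r.
by rewrite comp_polyM comp_Xn_poly dvdp_mull.
Qed.

Lemma coprimep_prodr (I : Type) (r : seq I) (P : pred I) (f : I -> {poly F}) (q : {poly F}) :
  (forall i, P i -> coprimep q (f i)) -> coprimep q (\prod_(i <- r | P i) f i).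
Proof.
by move=> h; elim/big_ind: _ => //; [exact: coprimep1|move=> u v; rewrite coprimepMr => ->].
Qed.

Lemma coprimep_roots i j : i != j ->
  coprimep (('X - (lam i)%:P) ^+ m i) (('X - (lam j)%:P) ^+ m j).
Proof.
move=> ij; apply: coprimep_expl; apply: coprimep_expr; apply: coprimep_XsubC2.
by rewrite subr_eq0 (inj_eq lam_inj) eq_sym.
Qed.

Lemma root_poly_dvdp (p : {poly F}) :
  (forall j, ('X - (lam j)%:P) ^+ m j %| p) -> root_poly %| p.
Proof.
move=> h; rewrite /root_poly.
elim: (index_enum _) (index_enum_uniq 'I_s) => [|j r IH] /=; first by rewrite big_nil dvd1p.
move=> /andP[jr ur]; rewrite big_cons Gauss_dvdp ?h ?IH //.
rewrite big_seq; apply: coprimep_prodr => i ir; apply: coprimep_roots.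
by apply: contraNneq jr => ->.
Qed.

Lemma root_poly_monic : root_poly \is monic.
Proof. by apply: monic_prod => j _; rewrite monic_exp // monicXsubC. Qed.

Lemma co_root_poly_monic j : co_root_poly j \is monic.
Proof. by apply: monic_prod => l _; rewrite monic_exp // monicXsubC. Qed.

Lemma size_root_poly : size root_poly = (\sum_(j < s) m j).+1.
Proof.
rewrite /root_poly size_prod => [|j _]; last by rewrite expf_neq0 // polyXsubC_eq0.
rewrite (eq_bigr (fun j => (m j + 1)%N)) => [|j _]; last by rewrite size_exp_XsubC addn1.
by rewrite big_split /= sum1_card -addSn addnK.
Qed.

Lemma size_co_root_poly j : (m j + size (co_root_poly j) = (\sum_(j < s) m j).+1)%N.
Proof.
rewrite -size_root_poly (root_polyE j) size_monicM ?monic_exp ?monicXsubC //; last first.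
  by rewrite monic_neq0 // co_root_poly_monic.
by rewrite size_exp_XsubC.
Qed.

(** The two sides agree modulo every [('X - lam j) ^ m j] and differ by a polynomial of degree below
    that of [root_poly]. Since [E] is chosen before [P], the coefficients depend affinely on those
    of [P], hence holomorphically on a parameter. *)
Lemma partial_fractions : exists E : 'I_s -> {poly F},
  forall P : {poly F}, P \is monic -> size P = (\sum_(j < s) m j).+1 ->
  P = root_poly + \sum_(j < s) \sum_(a < m j)
        taylor_coef (lam j) (P * E j) a *: (('X - (lam j)%:P) ^+ a * co_root_poly j).
Proof.
(* [E j] is the inverse of [D_j] modulo [(t - lam j)^(m j)]. *)
have /boolp.choice[E HE] : forall j, exists E : {poly F},
    ('X - (lam j)%:P) ^+ m j %| 1 - E * co_root_poly j.
  move=> j.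
  have : coprimep (('X - (lam j)%:P) ^+ m j) (co_root_poly j).
    by apply: coprimep_prodr => l lj; apply: coprimep_roots; rewrite eq_sym.
  move=> /Bezout_eq1_coprimepP[[u v] /= uv]; exists v.
  by rewrite -uv addrK dvdp_mull.
exists E => P Pm sP.
pose T j := \sum_(a < m j) taylor_coef (lam j) (P * E j) a *: ('X - (lam j)%:P) ^+ a.
have -> : \sum_(j < s) \sum_(a < m j) taylor_coef (lam j) (P * E j) a *:
    (('X - (lam j)%:P) ^+ a * co_root_poly j) = \sum_(j < s) T j * co_root_poly j.
  by apply: eq_bigr => j _; rewrite mulr_suml; apply: eq_bigr => a _; rewrite scalerAl.
apply/eqP; rewrite -subr_eq0 opprD addrA; set Q := (X in X == 0).
have dvdQ : root_poly %| Q.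
  apply: root_poly_dvdp => j.
  (* Each part is divisible by [('X - lam j) ^ m j]: the first by the choice of [E j], the second by
     Taylor expansion, and the rest because its terms contain that factor. *)
  have -> : Q = P * (1 - E j * co_root_poly j) + (P * E j - T j) * co_root_poly j
      - (root_poly + \sum_(l < s | l != j) T l * co_root_poly l).
    by rewrite /Q (bigD1 j) //=; ring.
  apply: dvdp_sub; apply: dvdp_add.
  - exact: dvdp_mull.
  - by apply: dvdp_mulr; exact: dvdp_taylor_rem.
  - by rewrite (root_polyE j) dvdp_mulr.
  - apply: (big_ind (fun q => _ %| q)) => [|u v|l lj]; [exact: dvdp0|exact: dvdp_add|apply: dvdp_mull].
    by rewrite /co_root_poly (bigD1 j) 1?eq_sym //= dvdp_mulr.
apply: contraTT dvdQ => Q0; apply/negP => /(dvdp_leq Q0); rewrite leqNgt size_root_poly ltnS => /negP; apply.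
have szB : (size (P - root_poly)%R <= \sum_(j < s) m j)%N.
  apply/leq_sizeP => k; rewrite leq_eqVlt => /orP[/eqP <-|kn]; rewrite coefB.
    move: Pm root_poly_monic; rewrite !monicE !lead_coefE sP size_root_poly /= => /eqP -> /eqP ->.
    by rewrite subrr.
  by rewrite !nth_default ?subrr // ?sP ?size_root_poly.
apply: leq_trans (size_polyD _ _) _; rewrite geq_max szB size_polyN.
apply: leq_trans (size_sum _ _ _) _; apply/bigmax_leqP => j _.
have [->|T0] := eqVneq (T j) 0; first by rewrite mul0r size_poly0.
rewrite size_Mmonic ?co_root_poly_monic //.
have sT : (size (T j) <= m j)%N.
  apply: leq_trans (size_sum _ _ _) _; apply/bigmax_leqP => a _.
  by apply: leq_trans (size_scale_leq _ _) _; rewrite size_exp_XsubC.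
have := size_co_root_poly j; have : (0 < size (co_root_poly j))%N.
  by rewrite size_poly_gt0 monic_neq0 // co_root_poly_monic.
move: sT; clear; move: (size _) (size _) (\sum_(_ < _) _)%N => u v w; lia.
Qed.

End PartialFractions.

(** The same block matrix is factored through each of its two Schur complements. *)
Lemma det_1B_rank1 (K : comNzRingType) n (c : 'cV[K]_n) (r : 'rV[K]_n) :
  \det (1%:M - c *m r) = 1 - (r *m c) 0 0.
Proof.
have e1 : block_mx 1%:M c r 1%:M = block_mx 1%:M 0 r 1%:M *m block_mx 1%:M c 0 (1%:M - r *m c).
  by rewrite mulmx_block !mul1mx !mul0mx !mulmx1 !addr0 addrC subrK.
have e2 : block_mx 1%:M c r 1%:M = block_mx 1%:M c 0 1%:M *m block_mx (1%:M - c *m r) 0 r 1%:M.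
  by rewrite mulmx_block !mul1mx !mul0mx !mulmx1 !add0r subrK.
have := congr1 determinant e2; rewrite e1 !det_mulmx det_lblock det_ublock det_ublock det_lblock.
by rewrite !det1 !mul1r !mulr1 det_mx11 !mxE => <-.
Qed.

Lemma poly_eq_horner (K : numDomainType) (p q : {poly K}) : (forall x, p.[x] = q.[x]) -> p = q.
Proof.
move=> pq; apply/eqP; rewrite -subr_eq0; apply/eqP.
apply: (@roots_geq_poly_eq0 _ _ [seq (i%:R : K) | i <- iota 0 (size (p - q)%R)]).
- by apply/allP => x _; rewrite rootE hornerD hornerN pq subrr.
- by rewrite map_inj_uniq ?iota_uniq // => i j /eqP; rewrite eqr_nat => /eqP.
- by rewrite size_map size_iota.
Qed.

Lemma horner_char_poly (K : comNzRingType) n (A : 'M[K]_n) (t : K) :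
  (char_poly A).[t] = \det (t%:M - A).
Proof.
rewrite -horner_evalE -det_map_mx; congr (\det _); apply/matrixP => i j.
by rewrite !mxE /= /horner_eval !(hornerE, hornerMn).
Qed.

(** * The rank one perturbation of a bidiagonal matrix *)

Section CyclicModel.
Variables (F : numClosedFieldType) (s : nat) (m : 'I_s -> nat) (lam : 'I_s -> F).
Hypothesis lam_inj : injective lam.
Hypothesis m_gt0 : forall j, (0 < m j)%N.
Variable sd : 'I_s -> nat -> F.

Definition bidiag (j : 'I_s) : 'M[F]_(m j) :=
  \matrix_(a, b) (lam j *+ (a == b) + sd j a *+ (a.+1 == b)).
Definition bidiag_mx := \mxdiag_j bidiag j.
Definition last_col := \mxcol_j (\col_(a < m j) ((a.+1 == m j)%:R : F)).
Definition weight_row (W : 'I_s -> nat -> F) := \mxrow_j (\row_(a < m j) W j a).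
Definition model_mx W := bidiag_mx + last_col *m weight_row W.

Lemma last_colE j (b : 'I_(m j)) : last_col (tagnat.Rank j b) 0 = (b.+1 == m j)%:R.
Proof.
have /matrixP/(_ b 0) := mxcolK (fun j => \col_(b < m j) ((b.+1 == m j)%:R : F)) j.
by rewrite [LHS]mxE [RHS]mxE.
Qed.

Lemma weight_rowE W j (b : 'I_(m j)) : weight_row W 0 (tagnat.Rank j b) = W j b.
Proof.
have /matrixP/(_ 0 b) := mxrowK (fun j => \row_(b < m j) W j b) j.
by rewrite [LHS]mxE [RHS]mxE.
Qed.

Lemma char_poly_bidiag : char_poly bidiag_mx = root_poly m lam.
Proof.
(* [char_poly_trig] expects a lower triangular matrix. *)
have -> : char_poly bidiag_mx = char_poly (bidiag_mx^T).
  rewrite /char_poly -det_tr; congr (\det _); apply/matrixP => i j.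
  by rewrite !mxE eq_sym.
rewrite /bidiag_mx tr_mxdiag char_poly_trig; last first.
  apply/is_trig_mxblockP; split=> [i j ij|i].
    by case: eqVneq ij => // ->; rewrite ltnn.
  rewrite eqxx conform_mx_id; apply/is_trig_mxP => a b ab; rewrite !mxE.
  rewrite -val_eqE (gtn_eqF ab) mulr0n add0r; case: eqP => // e.
  by move: ab; rewrite -e ltnNge leqnSn.
rewrite /root_poly.
under [RHS]eq_bigr => j _.
  rewrite (_ : _ ^+ _ = \prod_(a < m j) ('X - (lam j)%:P)); last by rewrite prodr_const card_ord.
  over.
rewrite sig_big_dep (reindex _ tagnat.sig_bij_on) /=.
apply: eq_bigr => i _; congr ('X - _%:P).
by rewrite mxE eqxx conform_mx_id !mxE eqxx mulr1n gtn_eqF // mulr0n addr0.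
Qed.

(** By the two hypotheses below, [g j a] is the product of the superdiagonal entries [sd j b] with
    [a <= b < m j - 1]. *)
Variable g : 'I_s -> nat -> F.
Hypothesis gS : forall j a, (a.+1 < m j)%N -> g j a = sd j a * g j a.+1.
Hypothesis g_last : forall j, g j (m j).-1 = 1.

Lemma char_poly_model W : char_poly (model_mx W) =
  root_poly m lam - \sum_(j < s) \sum_(a < m j)
     (W j a * g j a) *: (('X - (lam j)%:P) ^+ a * co_root_poly m lam j).
Proof.
set D := root_poly m lam; set S := (X in _ = D - X).
suff H (t : F) : D.[t] != 0 -> (char_poly (model_mx W)).[t] = (D - S).[t].
  (* Multiplication by [D] disposes of the roots of [D], at which [t - N] is singular. *)
  apply: (@mulfI _ D); first by rewrite monic_neq0 // root_poly_monic.
  apply: poly_eq_horner => t; rewrite !hornerM.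
  by have [->|/H ->] := eqVneq D.[t] 0; rewrite ?mul0r.
move=> Dt0.
(* [(t - N) x = D(t) u], so [1 - w (t - N)^-1 u = 1 - w x / D(t)]. *)
pose x := \mxcol_j (\col_(a < m j) (g j a * (('X - (lam j)%:P) ^+ a * co_root_poly m lam j).[t])).
have Nx : (t%:M - bidiag_mx) *m x = D.[t] *: last_col.
  rewrite -(mxdiagZ (p_ := m)) -mxdiagB mul_mxdiag_mxcol.
  rewrite -mul_scalar_mx -(mxdiagZ (p_ := m)) mul_mxdiag_mxcol; apply/eq_mxcolP => j.
  rewrite mul_scalar_mx; apply/colP => a; rewrite !mxE.
  rewrite (bigD1 a) //= !mxE eqxx !mulr1n (gtn_eqF (ltnSn a)) mulr0n addr0.
  (* In the last row of a group the entry is [(t - lam j) ^ m j] times the cofactor, that is [D(t)];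
     in the other rows the diagonal and superdiagonal terms cancel by [gS]. *)
  have := ltn_ord a; rewrite leq_eqVlt => /orP[/eqP a1|a1].
    rewrite a1 eqxx mulr1 big1 ?addr0 => [|b ba].
      have e : (m j).-1 = a := esym (congr1 predn a1).
      have eX : ('X - (lam j)%:P) ^+ m j = ('X - (lam j)%:P) * ('X - (lam j)%:P) ^+ (m j).-1.
        by rewrite -exprS prednK.
      rewrite -e g_last mul1r hornerM /D (root_polyE m lam j) eX !hornerM.
      by rewrite mulrA hornerXsubC.
    rewrite !mxE eq_sym (negbTE ba) mulr0n a1 (gtn_eqF (ltn_ord b)) !mulr0n.
    by rewrite addr0 subr0 mul0r.
  rewrite (ltn_eqF a1) mulr0 (bigD1 (Ordinal a1)) ?big1 ?addr0 => [|b /andP[ba bS]|] /=; last first.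
  - by rewrite -val_eqE /= gtn_eqF.
  - have aSb : (a.+1 == b) = false by apply/negbTE; rewrite eq_sym.
    by rewrite !mxE aSb [a == b]eq_sym (negbTE ba) !mulr0n addr0 subr0 mul0r.
  - have aa : (a == Ordinal a1) = false by rewrite -val_eqE /= ltn_eqF.
    rewrite !mxE aa eqxx !mulr0n mulr1n !add0r.
    have eX : ('X - (lam j)%:P) ^+ Ordinal a1 = ('X - (lam j)%:P) * ('X - (lam j)%:P) ^+ a := exprS _ _.
    rewrite (gS a1) eX -[g j (Ordinal a1)]/(g j a.+1) !hornerM hornerXsubC; ring.
have wx : (weight_row W *m x) 0 0 = S.[t].
  rewrite mul_mxrow_mxcol summxE horner_sum; apply: eq_bigr => j _.
  rewrite mxE horner_sum; apply: eq_bigr => a _.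
  by rewrite !mxE hornerZ mulrA.
have detN : \det (t%:M - bidiag_mx) = D.[t].
  by rewrite /D -char_poly_bidiag horner_char_poly.
have ex : last_col = (D.[t])^-1 *: ((t%:M - bidiag_mx) *m x).
  by rewrite Nx scalerA mulVf // scale1r.
rewrite horner_char_poly /model_mx opprD addrA.
have -> : t%:M - bidiag_mx - last_col *m weight_row W =
   (t%:M - bidiag_mx) *m (1%:M - ((D.[t])^-1 *: x) *m weight_row W).
  by rewrite mulmxBr mulmx1 {1}ex mulmxA scalemxAr.
rewrite det_mulmx det_1B_rank1 detN -scalemxAr mxE wx hornerD hornerN.
by rewrite mulrBr mulr1 mulrA divff // mul1r.
Qed.

Hypothesis sd_neq0 : forall j a, (a.+1 < m j)%N -> sd j a != 0.

Lemma bidiag_left_eigen (y : 'rV[F]_(\sum_j m j)) (mu : F) :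
  y *m bidiag_mx = mu *: y -> forall j (b : 'I_(m j)),
  (lam j - mu) * submxrow y j 0 b = - \sum_(a < m j | a.+1 == b) submxrow y j 0 a * sd j a.
Proof.
rewrite -[y]submxrowK mul_mxrow_mxdiag -mul_mx_scalar -(mxdiagZ (p_ := m)) mul_mxrow_mxdiag.
move=> /eq_mxrowP yN j b; have /rowP/(_ b) := yN j.
rewrite mxrowK; set z := submxrow y j; rewrite mul_mx_scalar [LHS]mxE [RHS]mxE => e.
have E : \sum_a z 0 a * bidiag j a b =
   \sum_a z 0 a * (lam j *+ (a == b)) + \sum_(a < m j | a.+1 == b) z 0 a * sd j a.
  rewrite [X in _ = _ + X]big_mkcond -big_split; apply: eq_bigr => a _.
  by rewrite [bidiag j a b]mxE mulrDr; case: (a.+1 == b); rewrite ?mulr1n // mulr0n mulr0.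
rewrite E (bigD1 b) //= eqxx mulr1n big1 ?addr0 in e => [|a /negbTE ->]; last by rewrite mulr0n mulr0.
by rewrite mulrBl -e; ring.
Qed.

(** As [y] kills [last_col], it is a left eigenvector of the bidiagonal part. Groups with
    [lam j != mu] vanish by recursion from the left; in the group with [lam j = mu] nonzero [sd]
    leaves only the last entry, which is then the value [y *m last_col]. *)
Lemma model_observable W (y : 'rV[F]_(\sum_j m j)) (mu : F) :
  y *m model_mx W = mu *: y -> y *m last_col = 0 -> y = 0.
Proof.
rewrite /model_mx mulmxDr mulmxA => + yu; rewrite yu mul0mx addr0 => /bidiag_left_eigen yN.
have y0 j : lam j != mu -> submxrow y j = 0.
  rewrite -subr_eq0 => lmu; apply/rowP => b; rewrite [RHS]mxE.
  have [k] := ubnP (val b); elim: k b => // k IH b bk.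
  apply: (mulfI lmu); rewrite mulr0 yN big1 ?oppr0 // => a /eqP ab.
  by rewrite IH ?mul0r // -ltnS (leq_trans _ bk) // ab.
have y1 j (a : 'I_(m j)) : lam j = mu -> (a.+1 < m j)%N -> submxrow y j 0 a = 0.
  move=> lmu am; have := yN j (Ordinal am); rewrite lmu subrr mul0r (bigD1 a) //= big1 => [/eqP|b].
    by rewrite addr0 eq_sym oppr_eq0 mulf_eq0 (negbTE (sd_neq0 am)) orbF => /eqP.
  by rewrite eqSS => /andP[/eqP/val_inj -> /eqP].
rewrite -[y]submxrowK; apply/mxrowP => j; rewrite mxrowK; apply/rowP => a.
rewrite -[0 in RHS]submxrowK mxrowK !mxE.
have [lmu|/y0] := eqVneq (lam j) mu; last by move/rowP => /(_ a); rewrite !mxE.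
have := ltn_ord a; rewrite leq_eqVlt => /orP[/eqP am|am]; last by have := y1 j a lmu am; rewrite mxE.
have := yu; rewrite -{1}[y]submxrowK mul_mxrow_mxcol => /matrixP/(_ 0 0).
rewrite summxE mxE (bigD1 j) //= big1 ?addr0 => [|l lj]; last first.
  by rewrite y0 ?mul0mx ?mxE // -lmu (inj_eq lam_inj).
rewrite mxE (bigD1 a) //= big1 ?addr0 => [|b ba].
  by rewrite !mxE am eqxx mulr1.
rewrite [X in _ * X]mxE; case: eqP => [bm|]; last by rewrite mulr0.
by case/eqP: ba; apply: val_inj; apply: succn_inj; rewrite bm.
Qed.

End CyclicModel.

(** * Krylov spaces and Hautus' criterion *)

Lemma horner_mx_sum (F : comNzRingType) n (A : 'M[F]_n.+1) (p : {poly F}) :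
  horner_mx A p = \sum_(i < size p) p`_i *: A ^+ i.
Proof.
rewrite -{1}[p]coefK poly_def rmorph_sum /=; apply: eq_bigr => i _.
by rewrite linearZ /= rmorphXn /= horner_mx_X.
Qed.

Lemma krylov_annihilate (F : fieldType) n (A : 'M[F]_n.+1) (u : 'cV[F]_n.+1) (y : 'rV[F]_n.+1) :
  (forall k : 'I_n.+1, y *m (A ^+ k *m u) = 0) -> forall k, y *m (A ^+ k *m u) = 0.
Proof.
move=> H k; have -> : A ^+ k = horner_mx A ('X^k %% char_poly A).
  rewrite -[in LHS](horner_mx_X A) -rmorphXn {1}(divp_eq 'X^k (char_poly A)).
  by rewrite rmorphD rmorphM /= Cayley_Hamilton mulr0 add0r.
rewrite horner_mx_sum mulmx_suml mulmx_sumr big1 // => i _.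
have iS : (i < n.+1)%N.
  rewrite -ltnS -(size_char_poly A); apply: leq_ltn_trans (ltn_ord i) _.
  by rewrite ltn_modp monic_neq0 // char_poly_monic.
by rewrite -scalemxAl -scalemxAr (H (Ordinal iS)) scaler0.
Qed.

(** Otherwise some nonzero [y] annihilates every [A ^ k u]. By Cayley-Hamilton the product of the
    factors [A - z] kills [y]; applied one at a time, they preserve the annihilation, and the last
    nonzero row is a left eigenvector orthogonal to [u]. *)
Lemma hautus (F : numClosedFieldType) n (A : 'M[F]_n) (u : 'cV[F]_n) :
  (forall (y : 'rV[F]_n) mu, y *m A = mu *: y -> y *m u = 0 -> y = 0) ->
  forall w : 'cV[F]_n, exists c : 'I_n -> F, w = \sum_(k < n) c k *: (A ^+ k *m u).
Proof.
case: n A u => [|n] A u obs w.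
  by exists (fun=> 0); rewrite !flatmx0.
pose G := \matrix_(k < n.+1) (A ^+ k *m u)^T.
have [Gfull|nfull] := boolP (row_full G).
  exists (fun k => (w^T *m pinvmx G) 0 k).
  have e : w^T = w^T *m pinvmx G *m G by rewrite mulmxKpV ?submx_full.
  apply: trmx_inj; rewrite [LHS]e [LHS]mulmx_sum_row raddf_sum /=; apply: eq_bigr => k _.
  by rewrite linearZ /= rowK.
have : kermx G^T != 0.
  by rewrite kermx_eq0 /row_free mxrank_tr.
case/rowV0Pn => y /sub_kermxP yG y0.
have yk : forall k, y *m (A ^+ k *m u) = 0.
  apply: krylov_annihilate => k; apply/matrixP => i j; rewrite !ord1 [RHS]mxE.
  move/rowP: yG => /(_ k); rewrite [LHS]mxE [RHS]mxE => <-; rewrite mxE; apply: eq_bigr => l _.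
  by congr (_ * _); rewrite [RHS]mxE [RHS]mxE [RHS]mxE.
have [rs Hrs] := closed_field_poly_normal (char_poly A).
have {Hrs} : y *m \prod_(z <- rs) (A - z%:M) = 0.
  move: (Cayley_Hamilton A); rewrite Hrs (eqP (char_poly_monic A)) scale1r rmorph_prod /= => CH.
  rewrite -[RHS](mulmx0 _ y) -CH; congr (y *m _); apply: eq_bigr => z _.
  by rewrite rmorphB /= horner_mx_X horner_mx_C.
elim: rs y y0 yk {yG} => [|z rs IH] y y0 yk.
  by rewrite big_nil mulmx1 => /eqP; rewrite (negbTE y0).
rewrite big_cons mulmxA.
have [yz|yz] := eqVneq (y *m (A - z%:M)) 0.
  have yA : y *m A = z *: y.
    by apply/eqP; rewrite -subr_eq0 -mul_mx_scalar -mulmxBr yz.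
  by case/eqP: y0; apply: obs yA _; have := yk 0; rewrite expr0 mul1mx.
apply: IH => // k; rewrite -mulmxA mulmxBl mulmxBr mul_scalar_mx -scalemxAr (yk k) scaler0 subr0.
by rewrite [X in y *m X]mulmxA -[_ *m _ ^+ _]/(A * A ^+ k) -exprS yk.
Qed.
(** * Counting Jordan blocks *)

Section BlockCount.
Local Open Scope nat_scope.
Implicit Types (t : pred nat) (b : nat) (l : seq nat).

(* [b :: l] lists the first position of each block, then the end of the last
   one; the flags tell which blocks are contained in [t]. *)
Fixpoint full_blocks t b l : seq bool :=
  if l is b' :: l' then all t (iota b (b' - b)) :: full_blocks t b' l' else [::].

Lemma size_full_blocks t b l : size (full_blocks t b l) = size l.
Proof. by elim: l b => //= b' l IH b; rewrite IH. Qed.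

Lemma path_ltn_last b l : path ltn b l -> b <= last b l.
Proof.
by elim: l b => //= b' l IH b /andP[bb' /IH]; apply: leq_trans; exact: ltnW.
Qed.

Lemma iota_split b b' e : b <= b' <= e -> iota b (e - b) = iota b (b' - b) ++ iota b' (e - b').
Proof.
move=> /andP[bb' b'e]; rewrite (_ : e - b = (b' - b) + (e - b')) ?iotaD ?subnKC //; lia.
Qed.

(** In a block not contained in [t], moving right from a position outside [t] reaches one whose
    successor is the end of the block or lies in [t]. Distinct blocks yield distinct such
    positions. *)
Lemma count_block_ends t (z : pred nat) b l : path ltn b l ->
  (forall p b', b' \in l -> b <= p < b' -> ~~ t p -> (p.+1 == b') || t p.+1 -> z p) ->
  count negb (full_blocks t b l) <= count z (iota b (last b l - b)).
Proof.
elim: l b => //= b' l IH b /andP[bb' pl] Hz.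
rewrite (@iota_split b b' (last b' l)); last by rewrite ltnW // path_ltn_last.
rewrite count_cat; apply: leq_add; last first.
  apply: IH => // p b'' b''l /andP[b'p pb'']; apply: (Hz _ b''); first by rewrite inE b''l orbT.
  by rewrite (leq_trans (ltnW bb') b'p).
case: (boolP (all t _)) => //= nall; rewrite -has_count.
have {}Hz p : b <= p < b' -> ~~ t p -> (p.+1 == b') || t p.+1 -> z p by apply: Hz; rewrite inE eqxx.
move: nall bb' Hz {IH pl}; rewrite -has_predC; case/hasP => p; rewrite mem_iota => /andP[bp pb'] /= tp bb' Hz.
have {}pb' : p < b' by move: pb'; rewrite subnKC // ltnW.
have [d] := ubnP (b' - p); elim: d p bp tp pb' => // d IH p bp tp pb' pd.
have [|] := boolP ((p.+1 == b') || t p.+1).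
  move=> pS; apply/hasP; exists p; last by apply: Hz; rewrite ?bp.
  by rewrite mem_iota bp subnKC // ltnW.
rewrite negb_or => /andP[pS tpS]; apply: (IH p.+1) => //; lia.
Qed.

Lemma sumn_full_blocks t b l : path ltn b l ->
  sumn (mask (full_blocks t b l) (pairmap (fun b b' => b' - b) b l)) <= count t (iota b (last b l - b)).
Proof.
elim: l b => //= b' l IH b /andP[bb' pl].
rewrite (@iota_split b b' (last b' l)); last by rewrite ltnW // path_ltn_last.
rewrite count_cat; case: (boolP (all t _)) => [|_] /=.
  by rewrite all_count size_iota => /eqP ->; rewrite leq_add2l IH.
by apply: leq_trans (IH _ pl) _; exact: leq_addl.
Qed.

Lemma sumn_take_sorted (x : nat) (l : seq nat) (k : nat) : path leq x l -> k < size l ->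
  x + sumn (take k l) <= sumn (take k.+1 l).
Proof.
elim: l x k => // y l IH x [|k] /= /andP[xy pl] kl; first by rewrite take0 !addn0.
by rewrite addnCA leq_add2l; apply: leq_trans (IH y k pl kl); rewrite leq_add2r.
Qed.

(** The ordering of the Jordan blocks enters here: among all choices of a given number of blocks,
    the first ones are the smallest in total. *)
Lemma sumn_take_mask (mk : bitseq) (l : seq nat) : size mk = size l -> sorted leq l ->
  sumn (take (count id mk) l) <= sumn (mask mk l).
Proof.
elim: l mk => [|x l IH] [|[] mk] //= [sml] pl.
  by rewrite leq_add2l IH // (path_sorted pl).
rewrite add0n; have cm : count id mk <= size l by rewrite -sml count_size.
apply: leq_trans (IH _ sml (path_sorted pl)).
case: (count id mk) cm => [|k] kl; first by rewrite take0.
exact: sumn_take_sorted.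
Qed.

Lemma add_sumn_take b l k : path ltn b l -> k <= size l ->
  b + sumn (take k (pairmap (fun b b' => b' - b) b l)) = nth 0 (b :: l) k.
Proof.
elim: l b k => [|b' l IH] b [|k] //=; rewrite ?addn0 // => /andP[bb' pl] kl.
by rewrite addnA subnKC ?(ltnW bb') // IH.
Qed.

Lemma count_gt_nth b l k c : path ltn b l -> k <= size l -> nth 0 (b :: l) k <= c ->
  count (fun p => c < p) l <= size l - k.
Proof.
elim: l b k => [|b' l IH] b [|k] //=.
  by rewrite subn0 => _ _ _; have := count_size (fun p => c < p) (b' :: l).
move=> /andP[bb' pl] kl kc; rewrite subSS.
have -> : c < b' = false.
  apply/negbTE; rewrite -leqNgt; apply: leq_trans kc.
  case: k kl => // k kl; rewrite /=; have := order_path_min ltn_trans pl.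
  by move/allP => /(_ (nth 0 l k)); rewrite mem_nth // => /(_ isT)/ltnW.
by rewrite add0n; exact: IH pl kl kc.
Qed.

(** If [f] blocks are contained in [t], the first [f] blocks have total size at most [k]. Hence the
    first [f] entries of [l] are at most [k + 1], and only the other ones can exceed it. *)
Lemma count_not_full (t : pred nat) (l : seq nat) (k : nat) : path ltn 1 l ->
  sorted leq (pairmap (fun b b' => b' - b) 1 l) -> count t (iota 1 (last 1 l - 1)) <= k ->
  count (fun p => k.+1 < p) l <= count negb (full_blocks t 1 l).
Proof.
move=> pl sl tk; pose f := count id (full_blocks t 1 l).
have fl : f <= size l by rewrite -(size_full_blocks t 1 l) count_size.
have -> : count negb (full_blocks t 1 l) = size l - f.
  rewrite -(size_full_blocks t 1 l) -(count_predC id) /f addKn.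
  by apply: eq_count.
apply: (@count_gt_nth 1) => //; rewrite -add_sumn_take // -[k.+1]add1n leq_add2l.
apply: leq_trans (sumn_take_mask _ sl) _; first by rewrite size_full_blocks size_pairmap.
exact: leq_trans (sumn_full_blocks t pl) tk.
Qed.

End BlockCount.

(** * Block starts of a Jordan form *)

Section JordanCount.
Variables (R : realType) (m : nat) (l : Cplx R) (B : 'M[Cplx R]_m).
Hypothesis jB : jordan_form l B.

Let Q (p : nat) := [exists j : 'I_m, (p == j.+1) &&
  [exists i : 'I_m, (i.+1 == j) && (B i j == 0)]].

Lemma block_startsE : block_starts B = [seq p <- iota 1 m | Q p].
Proof.
rewrite /block_starts -[iota 1 m]/(iota (1 + 0) m) iotaDl -val_enum_ord -map_comp filter_map.
congr map; apply: eq_filter => j /=; apply/idP/existsP => [H|[j' /andP[/eqP e]]].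
  by exists j; rewrite add1n eqxx.
by move: e; rewrite /= add1n => /succn_inj/val_inj ->.
Qed.

Lemma block_starts_bounds p : p \in block_starts B -> (1 < p <= m)%N.
Proof.
rewrite block_startsE mem_filter => /andP[/existsP[j /andP[/eqP-> /existsP[i /andP[/eqP ij _]]]] _].
by rewrite -ij /= ij ltn_ord.
Qed.

Lemma block_starts_path : (0 < m)%N -> path ltn 1 (rcons (block_starts B) m.+1).
Proof.
move=> m0; have Hst := block_starts_bounds.
rewrite rcons_path path_sortedE; last exact: ltn_trans.
apply/andP; split; first (apply/andP; split).
- by apply/allP => p /Hst/andP[].
- by rewrite block_startsE; apply: sorted_filter; [exact: ltn_trans|exact: iota_ltn_sorted].
- by have := mem_last 1%N (block_starts B); rewrite inE /= => /orP[/eqP->|/Hst/andP[]].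
Qed.

Lemma mem_block_starts (a b : 'I_m) : b = a.+1 :> nat ->
  (b.+1 \in block_starts B) = (B a b == 0).
Proof.
move=> ab; rewrite block_startsE mem_filter mem_iota /= add1n ltnS (ltn_ord b) andbT.
apply/existsP/eqP => [[j /andP[/eqP/succn_inj/val_inj <- /existsP[i /andP[/eqP ib /eqP]]]]|Bab].
  by have -> : i = a by apply: val_inj; apply: succn_inj; rewrite ib ab.
by exists b; rewrite eqxx; apply/existsP; exists a; rewrite ab eqxx Bab eqxx.
Qed.

(** The rows counted have a superdiagonal entry that is absent, zero, or in a column of [T]; every
    block not contained in [T] has one. *)
Lemma djordan_le_free (T : {set 'I_m}) (k : nat) : (#|T| <= k < m)%N ->
  (djordan B (m - k) <= #|[set a : 'I_m | (a \notin T) &&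
     [forall b : 'I_m, (b == a.+1 :> nat) ==> (b \in T) || (B a b == 0%R)]]%SET|)%N.
Proof.
move=> /andP[Tk km]; pose l' := rcons (block_starts B) m.+1.
pose t (p : nat) := [exists a : 'I_m, (p == a.+1) && (a \in T)].
have tE (a : 'I_m) : t a.+1 = (a \in T).
  apply/existsP/idP => [[a' /andP[/eqP/succn_inj/val_inj -> //]]|aT].
  by exists a; rewrite eqxx.
have m0 : (0 < m)%N := leq_ltn_trans (leq0n k) km.
have pl := block_starts_path m0; have [_ _ _ sl] := jB.
have lastl : last 1%N l' = m.+1 by rewrite last_rcons.
have iotaE : iota 1 m = [seq a.+1 | a <- map val (enum 'I_m)].
  by rewrite val_enum_ord -[RHS](iotaDl 1 0).
pose Z := [set a : 'I_m | (a \notin T) &&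
     [forall b : 'I_m, (b == a.+1 :> nat) ==> (b \in T) || (B a b == 0%R)]]%SET.
pose z (p : nat) := [exists a : 'I_m, (p == a.+1) && (a \in Z)].
have zE (a : 'I_m) : z a.+1 = (a \in Z).
  apply/existsP/idP => [[a' /andP[/eqP/succn_inj/val_inj -> //]]|aT].
  by exists a; rewrite eqxx.
have count_set (P : pred nat) (S : {set 'I_m}) : (forall a : 'I_m, P a.+1 = (a \in S)) ->
    count P (iota 1 m) = #|S|.
  move=> PS; rewrite iotaE -map_comp count_map cardE size_filter.
  by rewrite enumT; apply: eq_count => a /=; rewrite PS.
have h1 : (count (fun p => k.+1 < p)%N l' <= count negb (full_blocks t 1 l'))%N.
  by apply: count_not_full => //; rewrite lastl subn1 (count_set t T tE).
have h2 : (count negb (full_blocks t 1 l') <= #|Z|)%N.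
  have := @count_block_ends t z 1%N l' pl; rewrite lastl subn1 /= (count_set z Z zE); apply.
  move=> p b' b'l /andP[p0 pb'] tp hp.
  have b'm : (b' <= m.+1)%N.
    move: b'l; rewrite mem_rcons inE => /orP[/eqP -> //|].
    rewrite block_startsE mem_filter mem_iota add1n => /andP[_ /andP[_]]; exact: ltnW.
  have pm : (p.-1 < m)%N by rewrite prednK // -ltnS (leq_trans pb').
  apply/existsP; exists (Ordinal pm); rewrite /= prednK // eqxx inE -tE /= prednK // tp /=.
  apply/forallP => b; apply/implyP => /eqP bp.
  case/orP: hp => [/eqP pb|]; last by move=> tp1; rewrite -tE bp tp1.
  rewrite -(mem_block_starts (a := Ordinal pm)) /= ?prednK // bp.
  move: b'l; rewrite -pb mem_rcons inE => /orP[/eqP e|-> ]; last by rewrite orbT.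
  by have := ltn_ord b; rewrite bp -ltnS e ltnn.
(* The final entry [m + 1] of [l'] accounts for the [1 +] in [djordan], and [m - (m - k) + 2 <= p]
   reads [k + 1 < p]. *)
apply: leq_trans (leq_trans h1 h2); rewrite /djordan /l' -cats1 count_cat /= addn0.
rewrite ltnS km addnC leq_add2r; apply: sub_count => p /andP[].
by rewrite subKn ?(ltnW km) // addn2.
Qed.

End JordanCount.
(** * Vanishing orders *)

(** Leibniz' formula with each factor expanded; [T] is the set of rows from which ['X] is taken. *)
Lemma coef_char_poly (K : comNzRingType) n (M : 'M[K]_n) (k : nat) :
  (char_poly M)`_k = \sum_(s : 'S_n) (-1) ^+ s * \sum_(T : {set 'I_n} | #|T| == k)
    \prod_i (if i \in T then (i == s i)%:R else - M i (s i)).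
Proof.
rewrite /char_poly /determinant coef_sum; apply: eq_bigr => s _.
have -> : ((-1) ^+ s : {poly K}) = ((-1) ^+ s)%:P by rewrite rmorphXn /= polyCN polyC1.
rewrite coefCM; congr (_ * _).
under eq_bigr => i _ do rewrite !mxE.
rewrite bigA_distr coef_sum [RHS]big_mkcond; apply: eq_bigr => T _.
have -> : \prod_i (if i \in T then 'X *+ (i == s i) else - (M i (s i))%:P) =
   (\prod_i (if i \in T then (i == s i)%:R else - M i (s i)))%:P * 'X^#|T|.
  rewrite rmorph_prod /= -prodr_const [X in _ * X]big_mkcond -big_split.
  apply: eq_bigr => i _; case: (i \in T) => /=; last by rewrite mulr1 polyCN.
  by case: (i == s i); rewrite ?mulr1n ?mulr0n ?mul1r ?mul0r.
by rewrite coefCM coefXn eq_sym; case: eqP; rewrite ?mulr1 ?mulr0.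
Qed.

Lemma taylor_coef_char_poly (K : numFieldType) n (M : 'M[K]_n) (c : K) (k : nat) :
  taylor_coef c (char_poly M) k = (char_poly (M - c%:M))`_k.
Proof.
rewrite /taylor_coef; suff -> : char_poly M \Po ('X + c%:P) = char_poly (M - c%:M) by [].
apply: poly_eq_horner => t; rewrite horner_comp !horner_char_poly !hornerE; congr (\det _).
by rewrite raddfD /= opprB addrA [LHS]addrAC addrAC.
Qed.

Lemma taylor_coef_deriv (K : numFieldType) (p : {poly K}) (c : K) (k : nat) :
  taylor_coef c p k *+ k`! = p^`(k).[c].
Proof.
rewrite nderivn_def hornerMn; congr (_ *+ _); rewrite /taylor_coef.
have -> : p \Po ('X + c%:P) = \poly_(i < size p) p^`N(i).[c].
  apply: poly_eq_horner => t; rewrite horner_comp !hornerE addrC nderiv_taylor ?horner_poly //.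
  exact: mulrC.
rewrite coef_poly; case: ltnP => // pk.
by rewrite nderivn_poly0 // horner0.
Qed.

(** * The order of a function at a point *)

Section Order.
Variable R : realType.
Local Notation C := (Cplx R).
Variable a : C.

(** The point [a] is excluded, to match [O] along [a^']; the value at [a] is recovered by
    [ordO_derivable0]. *)
Definition ordO (d : nat) (f : C -> C) := exists2 K : R, 0 <= K &
  \forall z \near a, z != a -> cnorm (f z) <= K * cnorm (z - a) ^+ d.

Lemma eqO_ordO d (f : C -> C) :
  (f : C -> C) =O_ (a^') (fun z => (z - a) ^+ d : C) <-> ordO d f.
Proof.
have cX (z : C) : `|z ^+ d| = toC (cnorm z ^+ d).
  by rewrite normrX cnormE -[RHS]/(real_complex R _) rmorphXn.
split=> [/eqO_exP[k k0 H]|[K K0 H]].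
  have [r r0 kr] := gt0_toC k0; exists r; first exact: ltW.
  move: H; rewrite near_withinE; apply: filterS => z H /H.
  by rewrite kr cX -toCM ler_cnorm.
apply/eqO_exP; exists (toC (K + 1)); first by rewrite -toC0 ltc_toC; lra.
rewrite near_withinE; move: H; apply: filterS => z H /H {}H.
rewrite cX -toCM ler_cnorm; apply: le_trans H _.
by rewrite ler_wpM2r ?exprn_ge0 ?cnorm_ge0 //; lra.
Qed.

Lemma near_close (e : R) : 0 < e -> \forall z \near a, cnorm (z - a) < e.
Proof. by move=> e0; apply/nbhs_cnormP; exists e. Qed.

Lemma ordO_le d d' f : (d' <= d)%N -> ordO d f -> ordO d' f.
Proof.
move=> dd [K K0 H]; exists K => //.
near=> z => za; apply: (@le_trans _ _ (K * cnorm (z - a) ^+ d)); first by move: za; near: z.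
have z1 : cnorm (z - a) <= 1 by apply: ltW; near: z; exact: near_close.
by rewrite ler_wpM2l // ler_wiXn2l ?cnorm_ge0.
Unshelve. all: by end_near. Qed.

Lemma ordO_cst c : ordO 0 (fun=> c).
Proof.
by exists (cnorm c); [exact: cnorm_ge0|near=> z => _; rewrite expr0 mulr1].
Unshelve. all: by end_near. Qed.

Lemma ordO0 d : ordO d (fun=> 0).
Proof.
by exists 0 => //; near=> z => _; rewrite mul0r cnorm0.
Unshelve. all: by end_near. Qed.

Lemma ordOD d f g : ordO d f -> ordO d g -> ordO d (fun z => f z + g z).
Proof.
move=> [K K0 Hf] [M M0 Hg]; exists (K + M); first exact: addr_ge0.
near=> z => za; apply: le_trans (cnormD _ _) _; rewrite mulrDl; apply: lerD.
  by move: za; near: z.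
by move: za; near: z.
Unshelve. all: by end_near. Qed.

Lemma ordOM d d' f g : ordO d f -> ordO d' g -> ordO (d + d') (fun z => f z * g z).
Proof.
move=> [K K0 Hf] [M M0 Hg]; exists (K * M); first exact: mulr_ge0.
near=> z => za; rewrite cnormM exprD mulrACA; apply: ler_pM; rewrite ?cnorm_ge0 //.
  by move: za; near: z.
by move: za; near: z.
Unshelve. all: by end_near. Qed.

Lemma ordOMl c d f : ordO d f -> ordO d (fun z => c * f z).
Proof. exact: ordOM (ordO_cst c). Qed.

Lemma ordO_sum (I : Type) (r : seq I) (P : pred I) d (f : I -> C -> C) :
  (forall i, P i -> ordO d (f i)) -> ordO d (fun z => \sum_(i <- r | P i) f i z).
Proof.
move=> H; elim: r => [|i r IH].
  by under eq_fun do rewrite big_nil; exact: ordO0.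
under eq_fun do rewrite big_cons; case: (boolP (P i)) => // Pi.
by apply: ordOD IH; exact: H.
Qed.

Lemma ordO_prod (I : finType) (e : I -> nat) (f : I -> C -> C) :
  (forall i, ordO (e i) (f i)) -> ordO (\sum_i e i)%N (fun z => \prod_i f i z).
Proof.
move=> H; elim: (index_enum I) => [|i r IH].
  rewrite big_nil (_ : (fun z => _) = (fun=> 1)); first exact: ordO_cst.
  by apply/funext => z; rewrite big_nil.
rewrite big_cons (_ : (fun z => _) = (fun z => f i z * \prod_(j <- r) f j z)).
  exact: ordOM.
by apply/funext => z; rewrite big_cons.
Qed.

Lemma ordO_derivable (f : C -> C) : derivable f a 1 -> ordO 1 (fun z => f z - f a).
Proof.
move=> /has_cderivP[c /(_ 1 ltr01)[d d0 H]].
exists (cnorm c + 1); first by rewrite addr_ge0 ?cnorm_ge0.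
near=> z => _; have za : cnorm (z - a) < d by near: z; exact: near_close.
have := H _ za; rewrite mul1r expr1 mulrDl mul1r => h.
have := cnormD (f z - f a - c * (z - a)) (c * (z - a)); rewrite subrK cnormM.
by move: h; clear; lra.
Unshelve. all: by end_near. Qed.

End Order.

Lemma Rank_inj s (m : 'I_s -> nat) j : injective (@tagnat.Rank _ m j).
Proof. by move=> b c /tagnat.rank_inj/eqP; rewrite eq_Tagged => /eqP. Qed.

Lemma sub_scalar_mxE (K : pzRingType) n (A : 'M[K]_n) c i i' :
  (A - c%:M) i i' = A i i' - c *+ (i == i').
Proof. by rewrite !mxE. Qed.

Section MxdiagEntries.
Variables (F : pzRingType) (s : nat) (m : 'I_s -> nat) (M : forall j, 'M[F]_(m j)).

Lemma mxdiag_Rank j (b c : 'I_(m j)) :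
  (\mxdiag_j M j) (tagnat.Rank j b) (tagnat.Rank j c) = M j b c.
Proof. by have /matrixP/(_ b c) := submxblock_diag M j; rewrite mxE. Qed.

Lemma mxdiag_Rank_neq j j' (b : 'I_(m j)) (c : 'I_(m j')) : j != j' ->
  (\mxdiag_j M j) (tagnat.Rank j b) (tagnat.Rank j' c) = 0.
Proof.
move=> jj.
have /matrixP/(_ b c) := mxblockK (p_ := m) (q_ := m)
  (fun j k => if j == k then conform_mx 0 (M j) else 0) j j'.
by rewrite (negbTE jj) !mxE.
Qed.

End MxdiagEntries.

Section JordanOrder.
Variables (R : realType).
Local Notation C := (Cplx R).
Variables (a : C) (s : nat) (m : 'I_s -> nat) (lam : 'I_s -> C).
Variable (B : forall j, 'M[C]_(m j)).
Hypothesis jB : forall j, jordan_form (lam j) (B j).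

(** In a row given by [djordan_le_free], the only entry that could be nonzero is on the
    superdiagonal in a column of [T]; the permutation cannot select it, being injective and already
    fixing that column. *)
Lemma count_zero_entries j k (p : 'S_(\sum_j m j)) (T : {set 'I_(\sum_j m j)}) :
  (k < m j)%N -> #|T| = k -> (forall i, i \in T -> p i = i) ->
  (djordan (B j) (m j - k) <=
   \sum_i (if i \in T then 0 else ((\mxdiag_j B j - (lam j)%:M)%R i (p i) == 0%R)))%N.
Proof.
move=> km Tk pT; pose Tj := [set b : 'I_(m j) | tagnat.Rank j b \in T]%SET.
have TjT : (#|Tj| <= k < m j)%N.
  rewrite km andbT -Tk -(card_imset _ (@Rank_inj _ _ j)).
  by apply: fintype.subset_leq_card; apply/fintype.subsetP => i /imsetP[b]; rewrite inE => bT ->.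
apply: leq_trans (djordan_le_free (jB j) TjT) _.
set Z := [set b : 'I_(m j) | _]%SET.
rewrite -(card_imset _ (@Rank_inj _ _ j)) -sum1_card big_mkcond; apply: leq_sum => i _.
case: ifP => // /imsetP[b bZ ->]; move: bZ; rewrite !inE => /andP[/negbTE -> /forallP bZ].
have [b1 b2 b3 _] := jB j.
rewrite lt0b sub_scalar_mxE.
case: (tagnat.Rank j b =P p (tagnat.Rank j b)) => [<-|pb].
  by rewrite mxdiag_Rank b1 subrr.
rewrite mulr0n subr0 -[p _]tagnat.sig2K.
have [e|ne] := eqVneq j (tagnat.sig1 (p (tagnat.Rank j b))); last by rewrite mxdiag_Rank_neq.
have [c ec] : exists c : 'I_(m j), p (tagnat.Rank j b) = tagnat.Rank j c.
  by rewrite -[p _]tagnat.sig2K; case: _ / e (tagnat.sig2 _) => c; exists c.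
rewrite tagnat.sig2K ec mxdiag_Rank.
have bc : b != c by apply: contra_notN pb => /eqP bc; rewrite ec bc.
have [bSc|bSc] := eqVneq b.+1 c; last by rewrite b3 //; exact/eqP.
have := bZ c; rewrite -bSc eqxx /= inE => /orP[cT|//].
by case/eqP: bc; apply: (@Rank_inj _ m j); apply: (@perm_inj _ p); rewrite ec pT.
Qed.

(** A Leibniz term vanishes identically unless [p] fixes [T]; otherwise each zero entry met at [a]
    contributes one order. *)
Lemma jordan_ordO (Phi : C -> 'M[C]_(\sum_j m j)) :
  Phi a = \mxdiag_j B j ->
  (forall i i', ordO a 1 (fun z => Phi z i i' - Phi a i i')) ->
  forall j k, (k < m j)%N ->
  ordO a (djordan (B j) (m j - k)) (fun z => (char_poly (Phi z - (lam j)%:M))`_k).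
Proof.
move=> Phia PhiO j k km.
under eq_fun do rewrite coef_char_poly.
apply: ordO_sum => p _; apply: ordOMl; apply: ordO_sum => T /eqP Tk.
have [pT|/existsNP[i /not_implyP[iT /eqP pi]]] := pselect (forall i, i \in T -> p i = i); last first.
  under eq_fun do rewrite (bigD1 i) //= iT eq_sym (negbTE pi) mul0r.
  exact: ordO0.
apply: ordO_le (count_zero_entries km Tk pT) _; apply: ordO_prod => i.
case: ifP => iT; first exact: ordO_cst.
rewrite -Phia; set i' := p i; set M0 := _ - _.
have e z : - (Phi z - (lam j)%:M) i i' = -1 * (Phi z i i' - Phi a i i') + - M0 i i'.
  by rewrite /M0 !mxE; ring.
rewrite (funext e).
have := ordOMl (-1) (PhiO i i').
case: eqP => [M00 h|_ /(ordO_le (leq0n 1)) h]; last by apply: ordOD h _; exact: ordO_cst.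
by rewrite M00 oppr0; apply: ordOD h _; exact: ordO0.
Qed.

End JordanOrder.

(** * Derivability of matrix functions and of quotients *)

Section Derivability.
Variable R : realType.
Local Notation C := (Cplx R).

Lemma derivable_entry m n (M : C -> 'M[C]_(m, n)) (z : C) i j :
  derivable M z 1 -> derivable (fun x => M x i j) z 1.
Proof.
move=> /cvg_ex[l Hl]; apply/cvg_ex; exists (l i j).
have := cvg_comp _ _ Hl (@coord_continuous _ _ _ i j l).
rewrite (_ : _ \o _ = fun h : C => h^-1 *: (((fun x => M x i j) \o shift z) (h *: 1) - M z i j)) //.
by apply/funext => h; rewrite /= !mxE.
Qed.

Lemma derivable_entries m n (M : C -> 'M[C]_(m, n)) (z : C) :
  (forall i j, derivable (fun x => M x i j) z 1) -> derivable M z 1.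
Proof.
move=> H.
have sum_der (r : seq ('I_m * 'I_n)) :
    derivable (fun x => \sum_(p <- r) M x p.1 p.2 *: delta_mx p.1 p.2 : 'M[C]_(m, n)) z 1.
  elim: r => [|p r IH].
    by under eq_fun do rewrite big_nil; exact: derivable_cst.
  under eq_fun do rewrite big_cons.
  apply: derivableD IH.
  have /cvg_ex[l Hl] := H p.1 p.2; apply/cvg_ex; exists (l *: delta_mx p.1 p.2).
  rewrite (_ : (fun h => _) = fun h : C =>
     (h^-1 *: (((fun x => M x p.1 p.2) \o shift z) (h *: 1) - M z p.1 p.2)) *: delta_mx p.1 p.2).
    exact: cvgZr_tmp.
  by apply/funext => h; rewrite /= -scalerBl scalerA.
have := sum_der (index_enum _).
rewrite (_ : (fun x => _) = M) //; apply/funext => x.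
by rewrite [RHS]matrix_sum_delta pair_big.
Qed.

Variable a : C.

(** The constant [f a] is [O(z - a)], because both [f z] and [f z - f a] are. *)
Lemma ordO_derivable0 (f : C -> C) (d : nat) : derivable f a 1 -> ordO a d.+1 f -> f a = 0.
Proof.
move=> df fO; have [K K0 HK] : ordO a 1 (fun=> f a).
  have := ordOD (ordO_le (ltn0Sn d) fO) (ordOMl (-1) (ordO_derivable df)).
  by congr ordO; apply/funext => z; ring.
apply/eqP; rewrite -cnorm_eq0 eq_le cnorm_ge0 andbT; apply/ler_addgt0Pl => /= e e0; rewrite addr0.
move/nbhs_cnormP: HK => [r r0 Hr].
pose t := Num.min (r / 2) (e / (K + 1)).
have t0 : 0 < t by rewrite lt_min !divr_gt0 //; lra.
have tr : t < r by apply: (@le_lt_trans _ _ (r / 2)); [rewrite ge_min lexx|lra].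
have te : t * (K + 1) <= e by rewrite -ler_pdivlMr; [rewrite ge_min lexx orbT|lra].
have nt : cnorm (a + toC t - a) = t by rewrite addrAC subrr add0r cnorm_toC gtr0_norm.
have := Hr (a + toC t); rewrite nt expr1 => /(_ tr) h.
apply: le_trans (h _) _; first by rewrite -subr_eq0 -cnorm_gt0 nt.
by move: te; rewrite mulrDr mulr1 mulrC; move: t0; clear; lra.
Qed.

(** The order exceeds [d] by one: this makes [0] the right value at [a], where the difference
    quotient is [f z / (z - a) ^ d.+1] and has a limit by [removable_quotient]. *)
Lemma derivable_quotient (U : set C) (f : C -> C) (d : nat) :
  open_nbhs a U -> (forall z, U z -> derivable f z 1) -> ordO a d.+1 f ->
  forall z, U z -> derivable (fun z => if z == a then 0 else f z / (z - a) ^+ d : C) z 1.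
Proof.
move=> [oU Ua] df fO z Uz; have [->|za] := eqVneq z a; last first.
  apply: (@near_eq_derivable _ _ _ (fun w => f w * ((w - a) ^+ d)^-1)).
    apply/nbhs_cnormP; exists (cnorm (z - a)) => [|w wz]; first by rewrite cnorm_gt0 subr_eq0.
    by case: eqP wz => // ->; rewrite cnormB ltxx.
  apply: derivableM; first exact: df.
  apply: (@derivableV _ _ (fun w => (w - a) ^+ d)); first by rewrite expf_neq0 // subr_eq0.
  elim: d {fO} => [|d IH]; first by under eq_fun do rewrite expr0; exact: derivable_cst.
  under eq_fun do rewrite exprS; apply: derivableM IH.
  by apply: derivableB.
have dfa : \forall z \near a, derivable f z 1.
  have : nbhs a U by apply: open_nbhs_nbhs.
  by apply: filterS.
have /cvg_ex[l /cvgrPdist_lt Hl] := removable_quotient dfa fO.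
apply/has_cderivP; exists l => e e0.
have e0' : 0 < toC e by rewrite -toC0 ltc_toC.
have := Hl _ e0'; rewrite near_withinE => /nbhs_cnormP[r r0 Hr]; exists r => // w wr.
rewrite eqxx subr0; case: eqVneq => [->|wa].
  by rewrite subrr mulr0 subrr cnorm0 mulr0.
have wa0 : w - a != 0 by rewrite subr_eq0.
have := Hr w wr wa; rewrite distrC ltr_cnorm => /ltW; rewrite -(ler_pM2r (x := cnorm (w - a))) ?cnorm_gt0 //.
rewrite -cnormM; congr (cnorm _ <= _); rewrite mulrBl exprSr invfM.
by rewrite mulrA divfK.
Qed.

End Derivability.

(** * Characteristic polynomials and Taylor coefficients along [phi] *)

Section CharPolySigma.
Variable R : realType.
Local Notation C := (Cplx R).

Lemma sigma_char_poly n (A A' : 'M[C]_n) : char_poly A = char_poly A' -> sigma A = sigma A'.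
Proof. by move=> e; rewrite /sigma e. Qed.

Lemma Omega_char_poly n (A A' : 'M[C]_n) : char_poly A = char_poly A' -> Omega n A -> Omega n A'.
Proof. by move=> e H c; rewrite /Sp /= eigenvalue_root_char -e -eigenvalue_root_char; exact: H. Qed.

Lemma open_unit_disc : open (@unit_disc R).
Proof.
rewrite openE => z z1; apply/nbhs_cnormP.
have {}z1 : cnorm z < 1 by move: z1; rewrite /unit_disc /= -toC1 ltr_cnorm.
exists (1 - cnorm z) => [|w wz]; first by rewrite subr_gt0.
rewrite /unit_disc /= -toC1 ltr_cnorm; have := cnormD (w - z) z; rewrite subrK; lra.
Qed.

(** Affine dependence on [x], through which derivability passes from [phi] to the Taylor
    coefficients. *)
Lemma Ppoly_taylor_coef n (c : C) (E : {poly C}) (k : nat) :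
  exists (u : C) (v : 'I_n -> C), forall x : 'rV[C]_n,
    taylor_coef c (Ppoly x * E) k = u + \sum_(j < n) v j * x 0 j.
Proof.
pose L (p : {poly C}) := taylor_coef c (p * E) k.
have LD p q : L (p + q) = L p + L q by rewrite /L /taylor_coef mulrDl comp_polyD coefD.
have LZ d p : L (d *: p) = d * L p by rewrite /L /taylor_coef -scalerAl comp_polyZ coefZ.
exists (L 'X^n), (fun j => (-1) ^+ j.+1 * L 'X^(n - j.+1)) => x.
rewrite -[LHS]/(L _) /Ppoly LD; congr (_ + _).
rewrite (big_morph L LD (_ : L 0 = 0)); last by rewrite /L /taylor_coef mul0r comp_poly0 coef0.
by apply: eq_bigr => j _; rewrite LZ mulrAC.
Qed.

Lemma derivable_taylor_coef n (phi : C -> 'rV[C]_n) c (E : {poly C}) k z : derivable phi z 1 ->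
  derivable (fun z => taylor_coef c (Ppoly (phi z) * E) k) z 1.
Proof.
move=> dphi; have [u [v uv]] := Ppoly_taylor_coef n c E k.
rewrite (_ : (fun z => _) = fun z => u + \sum_(j < n) v j * phi z 0 j); last exact/funext.
apply: derivableD; first exact: derivable_cst.
elim: (index_enum _) => [|j r IH].
  by under eq_fun do rewrite big_nil; exact: derivable_cst.
under eq_fun do rewrite big_cons; apply: derivableD IH.
apply: derivableM; first exact: derivable_cst.
exact: derivable_entry.
Qed.

Lemma taylor_coefM (c : C) (p q : {poly C}) (k : nat) :
  taylor_coef c (p * q) k = \sum_(b < k.+1) taylor_coef c p b * taylor_coef c q (k - b).
Proof. by rewrite /taylor_coef comp_polyM coefM. Qed.

End CharPolySigma.

Section BlockSize.
Variables (R : realType) (m : nat) (B : 'M[Cplx R]_m).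

(** [block_starts] is 1-based: the 0-based position [a] is [a + 1] there, so later starts are at
    least [a + 2]. *)
Definition breaks_after (a : nat) := count (leq a.+2) (block_starts B).

Lemma djordanE a : (a < m)%N -> djordan B (m - a) = (breaks_after a).+1.
Proof.
move=> am; rewrite /djordan add1n; congr _.+1; apply: eq_in_count => p /(block_starts_bounds (B := B))/andP[_ pm].
by rewrite subKn ?(ltnW am) // addn2 pm andbT.
Qed.

Lemma breaks_afterS a : breaks_after a = ((a.+2 \in block_starts B) + breaks_after a.+1)%N.
Proof.
have ub : uniq (block_starts B).
  by rewrite block_startsE filter_uniq // iota_uniq.
rewrite /breaks_after -(count_uniq_mem _ ub) -count_predUI.
rewrite [X in (_ + X)%N](_ : _ = 0%N) ?addn0; last first.
  by apply/eqP; rewrite -leqn0 leqNgt -has_count; apply/hasPn => p _ /=; case: eqP => // ->; rewrite ltnn.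
by apply: eq_count => p /=; rewrite leq_eqVlt eq_sym.
Qed.

Lemma breaks_after_last : breaks_after m.-1 = 0%N.
Proof.
apply/eqP; rewrite -leqn0 leqNgt -has_count; apply/hasPn => p /(block_starts_bounds (B := B))/andP[p1 pm].
by rewrite -ltnNge ltnS (leq_trans pm) // leqSpred.
Qed.

End BlockSize.
(** * The lifting *)

Section Lifting.
Variables (R : realType).
Local Notation C := (Cplx R).
Variables (a : C) (s : nat) (m : 'I_s -> nat) (lam : 'I_s -> C).
Variable (B : forall j, 'M[C]_(m j)).
Hypothesis lam_inj : injective lam.
Hypothesis m_gt0 : forall j, (0 < m j)%N.
Hypothesis jB : forall j, jordan_form (lam j) (B j).
Local Notation n := (\sum_j m j)%N.
Variables (U : set C) (phi : C -> 'rV[C]_n).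
Hypothesis oU : open_nbhs a U.
Hypothesis phi_hol : Hol U (sym_polydisc n) phi.

Lemma lifting_order (Phi : C -> 'M[C]_n) (U' : set C) :
  open_nbhs a U' -> Hol U' (Omega n) Phi ->
  (forall z, (U' `&` U) z -> sigma (Phi z) = phi z) -> Phi a = \mxdiag_j B j ->
  forall j k, (k < m j)%N ->
  ordO a (djordan (B j) (m j - k)) (fun z => ((Ppoly (phi z))^`(k)).[lam j]).
Proof.
move=> [oU' U'a] [dPhi _] sPhi Phia j k km.
have PhiO i i' : ordO a 1 (fun z => Phi z i i' - Phi a i i').
  by apply: (ordO_derivable (f := fun z => Phi z i i')); apply: derivable_entry; exact: dPhi.
have /(ordOMl (k`!)%:R)[K K0 HK] := jordan_ordO jB Phia PhiO km.
exists K => //.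
have nU : nbhs a (U' `&` U).
  by apply: filterI; apply: open_nbhs_nbhs.
near=> z => za.
have UUz : (U' `&` U) z by near: z.
rewrite -(sPhi z UUz) -char_poly_sigma -taylor_coef_deriv taylor_coef_char_poly -mulr_natl.
by move: za; near: z.
Unshelve. all: by end_near. Qed.

Hypothesis phi_order : forall j k, (k < m j)%N ->
  ordO a (djordan (B j) (m j - k)) (fun z => ((Ppoly (phi z))^`(k)).[lam j]).

(* [e j b] jumps occur after the 0-based position [b] of the group [j], and
   [djordan (B j) (m j - b) = e j b + 1]. *)
Let e (j : 'I_s) := breaks_after (B j).

(** Multiplication by [E] mixes in only coefficients of index [b <= k], whose orders are no smaller
    since [e j] is nonincreasing. *)
Lemma taylor_coef_ordO (E : {poly C}) j k : (k < m j)%N ->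
  ordO a (e j k).+1 (fun z => taylor_coef (lam j) (Ppoly (phi z) * E) k).
Proof.
move=> km; under eq_fun do rewrite taylor_coefM.
apply: ordO_sum => b _; under eq_fun do rewrite mulrC; apply: ordOMl.
have bk : (b <= k)%N by rewrite -ltnS.
have bm : (b < m j)%N := leq_ltn_trans bk km.
have eb : (e j k <= e j b)%N by apply: sub_count => p /=; apply: leq_trans; rewrite !ltnS.
apply: (@ordO_le _ _ (e j b).+1) => //.
have := ordOMl ((b`!)%:R^-1) (phi_order bm); rewrite djordanE //.
congr ordO; apply/funext => z; rewrite -taylor_coef_deriv -(mulr_natl (taylor_coef _ _ _)) mulrA mulVf ?mul1r //.
Qed.

(** Row [b] has its superdiagonal entry in the 1-based column [b + 2]. The value is that of [B j] at
    [z = a] and is nonzero elsewhere. *)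
Let sd (z : C) (j : 'I_s) (b : nat) : C := if b.+2 \in block_starts (B j) then z - a else 1.
(** The product of the superdiagonal entries from row [b] on, [e j b] of which equal [z - a]. *)
Let g (z : C) (j : 'I_s) (b : nat) : C := (z - a) ^+ e j b.

Let g_rec z j b : (b.+1 < m j)%N -> g z j b = sd z j b * g z j b.+1.
Proof.
move=> _; rewrite /g /e breaks_afterS exprD /sd.
by case: (_ \in _); rewrite ?expr1 ?expr0.
Qed.

Let g_last z j : g z j (m j).-1 = 1.
Proof. by rewrite /g /e breaks_after_last. Qed.

Lemma jordan_bidiag j : bidiag m lam (sd a) j = B j.
Proof.
have [b1 b2 b3 _] := jB j; apply/matrixP => b c; rewrite mxE.
have [<-|bc] := eqVneq b c; first by rewrite b1 gtn_eqF // mulr0n addr0.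
rewrite mulr0n add0r; case: eqP => [bSc|bSc]; last by rewrite mulr0n b3.
rewrite mulr1n /sd bSc (mem_block_starts _ (esym bSc)).
by case: eqP => [->|Bbc]; [rewrite subrr|case: (b2 _ _ bSc)].
Qed.

Lemma order_lifting : exists (U' : set C) (Phi : C -> 'M[C]_n),
  [/\ open_nbhs a U' /\ U' `<=` U, Hol U' (Omega n) Phi,
      forall z, U' z -> sigma (Phi z) = phi z, Phi a = \mxdiag_j B j
    & forall z, (U' `\ a) z -> cyclic_mx (Phi z)].
Proof.
have [E HE] := partial_fractions m lam_inj.
pose r j b z := taylor_coef (lam j) (Ppoly (phi z) * E j) b.
(* Solves [W * g = - r], the sign being that of the sum in [char_poly_model]; the value [0] at [a]
   makes the perturbation vanish there. *)
pose W z (j : 'I_s) b : C := if z == a then 0 else - r j b z / (z - a) ^+ e j b.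
pose Phi z := model_mx m lam (sd z) (W z).
have [opU Ua] := oU; have [dphi sphi] := phi_hol.
have Wg z j b : (b < m j)%N -> W z j b * g z j b = - r j b z.
  move=> bm; rewrite /W /g; case: eqVneq => [->|za]; last by rewrite divfK // expf_neq0 // subr_eq0.
  (* At [z = a] both sides are zero, as [r] has positive order. *)
  rewrite mul0r /r (@ordO_derivable0 _ a (fun z => taylor_coef (lam j) (Ppoly (phi z) * E j) b) (e j b)) ?oppr0 //.
    by apply: derivable_taylor_coef; exact: dphi.
  exact: taylor_coef_ordO.
have cPhi z : U z -> char_poly (Phi z) = Ppoly (phi z).
  move=> Uz; have [A _ Az] := sphi z Uz.
  rewrite /Phi (char_poly_model lam m_gt0 (@g_rec z) (@g_last z)).
  have := HE (Ppoly (phi z)); rewrite -Az -char_poly_sigma char_poly_monic size_char_poly.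
  move=> /(_ isT erefl) ->; congr (_ + _); rewrite -sumrN; apply: eq_bigr => j _.
  rewrite -sumrN; apply: eq_bigr => b _.
  by rewrite Wg // scaleNr opprK /r -Az -char_poly_sigma.
(* No shrinking is required: the formulas hold on all of [U]. *)
exists U, Phi; split.
- by split.
- split=> z Uz; last first.
    have [A OA Az] := sphi z Uz; apply: Omega_char_poly OA.
    by rewrite cPhi // -Az char_poly_sigma.
  apply: derivable_entries => i i'.
  rewrite -(tagnat.sig2K i) -(tagnat.sig2K i').
  move: (tagnat.sig1 i) (tagnat.sig2 i) (tagnat.sig1 i') (tagnat.sig2 i') => j b j' b'.
  have PhiE x : Phi x (tagnat.Rank j b) (tagnat.Rank j' b') =
     bidiag_mx m lam (sd x) (tagnat.Rank j b) (tagnat.Rank j' b') + (b.+1 == m j)%:R * W x j' b'.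
    by rewrite /Phi /model_mx mxE [X in _ + X]mxE big_ord1 last_colE weight_rowE.
  under eq_fun do rewrite PhiE.
  apply: derivableD.
    have [jj|jj] := eqVneq j j'; last first.
      by under eq_fun do rewrite mxdiag_Rank_neq //; exact: derivable_cst.
    case: _ / jj b' {PhiE} => b'.
    under eq_fun do rewrite mxdiag_Rank mxE.
    apply: derivableD; first exact: derivable_cst.
    case: (b.+1 == b'); last by under eq_fun do rewrite mulr0n; exact: derivable_cst.
    under eq_fun do rewrite mulr1n /sd.
    case: (_ \in _); last exact: derivable_cst.
    by apply: derivableB.
  apply: derivableM; first exact: derivable_cst.
  have rO : ordO a (e j' b').+1 (fun z => - r j' b' z).
    have := ordOMl (-1) (taylor_coef_ordO (E j') (ltn_ord b')).
    by congr ordO; apply/funext => x; rewrite mulN1r.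
  apply: (derivable_quotient oU _ rO) => // x Ux.
  by apply: derivableN; apply: derivable_taylor_coef; exact: dphi.
- move=> z Uz; have [A _ Az] := sphi z Uz.
  by rewrite -Az; apply: sigma_char_poly; rewrite cPhi // -Az char_poly_sigma.
- rewrite /Phi /model_mx (_ : weight_row _ _ = 0) ?mulmx0 ?addr0.
    by apply: eq_mxdiag => j; exact: jordan_bidiag.
  apply/mxrowP => j; rewrite mxrowK; apply/rowP => b; rewrite !mxE /W eqxx.
  done.
- move=> z [Uz za]; exists (last_col _ m) => w.
  (* Off [a] all superdiagonal entries, [1] or [z - a], are nonzero, so [model_observable]
     applies. *)
  have [|c ->] := @hautus C n (Phi z) (last_col _ m) _ w.
    move=> y mu; apply: (model_observable lam_inj) => j b bm.
    rewrite /sd; case: (_ \in _); rewrite ?oner_neq0 // subr_eq0; exact/eqP.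
  by exists n, c.
Qed.

End Lifting.

(** * The equivalence of lifting, vanishing orders and cyclic lifting *)

Theorem proposition11 (R : realType) (n : nat)
  (alpha : Cplx R) (halpha : unit_disc alpha)
  (omega : set (Cplx R)) (homega : open_nbhs alpha omega)
  (phi : Cplx R -> 'rV[Cplx R]_n) (hphi : Hol omega (sym_polydisc n) phi)
  (s : nat) (m : 'I_s -> nat) (hn : (\sum_(j < s) m j)%N = n)
  (lambda : 'I_s -> Cplx R) (hlambda : injective lambda)
  (B : forall j : 'I_s, 'M[Cplx R]_(m j))
  (hSp : forall j, Sp (B j) = [set lambda j])
  (hB : forall j, jordan_form (lambda j) (B j))
  (A1 : 'M[Cplx R]_n) (hA1 : A1 = castmx (hn, hn) (\mxdiag_(j < s) B j)) :
  [<-> (* (a) *)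
       exists (omega' : set (Cplx R)) (Phi : Cplx R -> 'M[Cplx R]_n),
         [/\ open_nbhs alpha omega' /\ omega' `<=` unit_disc,
             Hol omega' (Omega n) Phi,
             forall zeta, (omega' `&` omega) zeta ->
               sigma (Phi zeta) = phi zeta
           & Phi alpha = A1];
       (* (b) *)
       forall (j : 'I_s) (k : nat), (k < m j)%N ->
         (fun zeta => ((Ppoly (phi zeta))^`(k)).[lambda j] : Cplx R)
           =O_ (alpha^')
         (fun zeta => (zeta - alpha) ^+ djordan (B j) (m j - k) : Cplx R);
       (* (c) *)
       exists (omega' : set (Cplx R)) (Phi : Cplx R -> 'M[Cplx R]_n),
         [/\ open_nbhs alpha omega' /\ omega' `<=` unit_disc,
             Hol omega' (Omega n) Phi,
             forall zeta, (omega' `&` omega) zeta ->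
               sigma (Phi zeta) = phi zeta,
             Phi alpha = A1
           & forall zeta, (omega' `\ alpha) zeta -> cyclic_mx (Phi zeta)]].
Proof.
case: _ / hn phi hphi A1 hA1 => phi hphi A1; rewrite castmx_id => ->.
(* An empty block has no eigenvalue, contrary to [hSp]. *)
have m_gt0 j : (0 < m j)%N.
  have : Sp (B j) (lambda j) by rewrite hSp.
  rewrite lt0n => /eigenvalueP[v _ v0]; apply: contra_neqN v0 => /eqP mj.
  by apply/rowP => -[i im]; exfalso; rewrite mj in im.
tfae.
- move=> [omega' [Phi [[ho _] hPhi sPhi Phia]]] j k km; apply/eqO_ordO.
  exact: (lifting_order hB homega ho hPhi sPhi Phia km).
- move=> hb.
  (* [order_lifting] returns a subset of the given neighborhood, which is therefore first cut down
     to the disc. *)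
  have oD : open_nbhs alpha (omega `&` unit_disc).
    have [oo oa] := homega; split=> //; apply: openI => //; exact: open_unit_disc.
  have hphi' : Hol (omega `&` unit_disc) (sym_polydisc (\sum_j m j)) phi.
    by have [h1 h2] := hphi; split=> z [zo _]; [exact: h1|exact: h2].
  have [|U' [Phi [[oU' sU'] h1 h2 h3 h4]]] := order_lifting hlambda m_gt0 hB oD hphi'.
    by move=> j k km; apply/eqO_ordO; exact: hb.
  exists U', Phi; split=> //.
  - by split=> // z /sU'[].
  - by move=> z [zU _]; exact: h2.
- by move=> [omega' [Phi [h1 h2 h3 h4 _]]]; exists omega', Phi.
Qed.
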